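(* Let $n\ge 4$ be an integer and let $\beta_1<\cdots<\beta_n$ be real numbers. Let $\lambda=\sum_{i=1}^{n-1}i(n-i)(\beta_{i+1}-\beta_i)>0$ and $$\nu_k=\frac{n-1}{\lambda\binom{n-1}{k+1}}\sum_{j=k+1}^{n-1}(n-j)\binom{j}{k+1}(\beta_{j+1}-\beta_j),\qquad k=0,\ldots,n-2.$$ For $0\le\varepsilon<1/2$ define the following real symmetric matrices. If $n=2m+2$: $$A_0(\varepsilon)=\big(\nu_{i+j}\big)_{i,j=0}^{m},\qquad B_0(\varepsilon)=\big(\nu_{i+j+1}-\nu_{i+j+2}-\varepsilon(1-\varepsilon)\nu_{i+j}\big)_{i,j=0}^{m-1},$$ with $A_0=A_0(0)$, $B_0=B_0(0)$. If $n=2m+3$: $$A_1(\varepsilon)=\big(\nu_{i+j+1}-\varepsilon\nu_{i+j}\big)_{i,j=0}^{m},\qquad B_1(\varepsilon)=\big((1-\varepsilon)\nu_{i+j}-\nu_{i+j+1}\big)_{i,j=0}^{m},$$ with $A_1=A_1(0)$, $B_1=B_1(0)$. Then: (i) If $n=2m+2$, the $\beta$'s are EOS if and only if $A_0(\varepsilon)\succeq 0$ and $B_0(\varepsilon)\succeq 0$ for some $\varepsilon\in(0,1/2)$. (ii) If $n=2m+3$, the $\beta$'s are EOS if and only if $A_1(\varepsilon)\succeq 0$ and $B_1(\varepsilon)\succeq 0$ for some $\varepsilon\in(0,1/2)$. (iii) If $n=2m+2$, the condition ''$A_0\succ 0$ and $B_0\succ 0$'' is sufficient, but not necessary, for the $\beta$'s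 to be EOS. Similarly, if $n=2m+3$, the condition ''$A_1\succ 0$ and $B_1\succ 0$'' is sufficient, but not necessary, for the $\beta$'s to be EOS. (Here ''not necessary'' means that for every such $n$ there exist $\beta_1<\cdots<\beta_n$ that are EOS but for which the condition fails.)
   Context: Real numbers $\beta_1<\cdots<\beta_n$ are called EOS (expected order statistics) if there exist i.i.d. integrable non-degenerate (not almost surely constant) real random variables $X_1,\ldots,X_n$ such that $\mathbb{E}X_{j:n}=\beta_j$ for $j=1,\ldots,n$, where $X_{1:n}\le\cdots\le X_{n:n}$ are the order statistics of $X_1,\ldots,X_n$ (the values arranged in nondecreasing order). For a real symmetric matrix $A$, $A\succ 0$ means that $A$ is positive definite and $A\succeq 0$ means that $A$ is positive semi-definite. *)

(* Defs.v *)
From HB Require Import structures.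
From mathcomp Require Import all_boot all_order all_algebra.
From mathcomp Require Import all_classical all_reals all_analysis.

Set Implicit Arguments.
Unset Strict Implicit.
Unset Printing Implicit Defensive.

Import Order.TTheory GRing.Theory Num.Theory.
Import numFieldNormedType.Exports.

Local Open Scope classical_set_scope.
Local Open Scope ring_scope.

Definition mutually_independent {d : measure_display} {T : measurableType d}
    {R : realType} (P : probability T R) (n : nat)
    (X : 'I_n -> {RV P >-> R}) : Prop :=
  forall (J : {set 'I_n}) (B : 'I_n -> set R), (forall i, measurable (B i)) ->
    (P (\bigcap_(i in [set` J]) (X i @^-1` B i)) =
     \prod_(i in J) P (X i @^-1` B i))%E.

Definition identically_distributed {d : measure_display}
    {T : measurableType d} {R : realType} (P : probability T R) (n : nat)
    (X : 'I_n -> {RV P >-> R}) : Prop :=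
  forall (i j : 'I_n) (B : set R), measurable B ->
    distribution P (X i) B = distribution P (X j) B.

Definition degenerate {d : measure_display} {T : measurableType d}
    {R : realType} (P : probability T R) (X : {RV P >-> R}) : Prop :=
  exists c : R, {ae P, forall w, X w = c}.

(* 0-based: [order_stat X k] is the order statistic X_{k+1:n}. *)
Definition order_stat {T : Type} {R : realType} (n : nat)
    (X : 'I_n -> T -> R) (k : 'I_n) (w : T) : R :=
  (sort <=%R [seq X i w | i <- enum 'I_n])`_k.

(* [tnth beta k] is beta_{k+1}. *)
Definition EOS {R : realType} (n : nat) (beta : n.-tuple R) : Prop :=
  exists (d : measure_display) (T : measurableType d) (P : probability T R)
         (X : 'I_n -> {RV P >-> R}),
    [/\ mutually_independent X,
        identically_distributed X,
        forall i, P.-integrable [set: T] (EFin \o X i),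
        forall i, ~ degenerate (X i)
      & forall k : 'I_n, ('E_P[order_stat X k] = (tnth beta k)%:E)%E].

Definition posdef {R : realType} (n : nat) (A : 'M[R]_n) : Prop :=
  A^T = A /\ forall v : 'rV[R]_n, v != 0 -> 0 < (v *m A *m v^T) 0 0.

Definition possemidef {R : realType} (n : nat) (A : 'M[R]_n) : Prop :=
  A^T = A /\ forall v : 'rV[R]_n, 0 <= (v *m A *m v^T) 0 0.

Section Moments.
Variables (R : realType) (n : nat) (beta : n.-tuple R).

(* beta_{j+1} - beta_j with 1-based indices, 1 <= j <= n - 1 *)
Definition gap (j : nat) : R := beta`_j - beta`_j.-1.

Definition lam : R := \sum_(1 <= i < n) (i * (n - i))%:R * gap i.

Definition nu (k : nat) : R :=
  n.-1%:R / (lam * 'C(n.-1, k.+1)%:R) *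
  \sum_(k.+1 <= j < n) ((n - j) * 'C(j, k.+1))%:R * gap j.

(* A0, B0 are for n = 2m+2 and A1, B1 for n = 2m+3, so that
   only nu 0, ..., nu (n - 2) occur. *)
Definition A0 (m : nat) (eps : R) : 'M[R]_m.+1 :=
  \matrix_(i, j) nu (i + j).

Definition B0 (m : nat) (eps : R) : 'M[R]_m :=
  \matrix_(i, j) (nu (i + j + 1) - nu (i + j + 2)
                  - eps * (1 - eps) * nu (i + j)).

Definition A1 (m : nat) (eps : R) : 'M[R]_m.+1 :=
  \matrix_(i, j) (nu (i + j + 1) - eps * nu (i + j)).

Definition B1 (m : nat) (eps : R) : 'M[R]_m.+1 :=
  \matrix_(i, j) ((1 - eps) * nu (i + j) - nu (i + j + 1)).

End Moments.

(* Main.v *)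
(** If X has distribution function F, then E X_{j+1:n} - E X_{j:n} is the
    integral of C(n,j) F^j (1-F)^(n-j) dx (Tonelli). Hence nu_k is the k-th
    moment of the probability measure on the open interval (0,1) proportional to
    the image of F(1-F) dx under F, and, the gaps being recovered from
    nu_0, ..., nu_(n-2), the beta's are EOS iff these are truncated moments of a
    measure on (0,1).
    Necessity: for such a measure the matrices at eps = 0 are positive
    semidefinite, and their isotropic vectors are isotropic for the Hankel
    matrix (nu_(i+j)) because the weights t, 1-t and t(1-t) do not vanish on
    (0,1); so in finite dimension they dominate a positive multiple of it.
    Sufficiency: for n odd, the moments are those of a Gauss quadrature whose
    nodes are roots of an orthogonal polynomial and lie in [eps, 1-eps]; for n
    even, a suitable value of the missing moment reduces to the odd case. A
    finitely supported measure is realized by a law with finitely many atoms. *)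
Require Import Defs.
From HB Require Import structures.
From mathcomp Require Import all_boot all_order all_algebra.
From mathcomp Require Import complex.
From mathcomp Require Import all_classical all_reals all_analysis.
From mathcomp Require Import measurable_realfun.
From mathcomp Require Import ring lra zify.
Import Order.TTheory GRing.Theory Num.Theory.
Import numFieldNormedType.Exports.
Set Implicit Arguments.
Unset Strict Implicit.
Unset Printing Implicit Defensive.
Local Open Scope ring_scope.

(** * Positive functionals on polynomials *)

Lemma discr_le0 (R : realFieldType) (A B C : R) :
  (forall x y, 0 <= x ^+ 2 * A + 2 * x * y * B + y ^+ 2 * C) -> B ^+ 2 <= A * C.
Proof.
move=> h; have A0 : 0 <= A by have := h 1 0; lra.
have C0 : 0 <= C by have := h 0 1; lra.
move: C0; rewrite le_eqVlt => /orP[/eqP C0|C0].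
- have [->|B0] := eqVneq B 0; first by rewrite expr0n /= -C0 mulr0.
  (* With [C = 0] the form is affine in [y]; this [y] makes its value at [x = 1] equal to [-1]. *)
  have := h 1 (- (A + 1) / (2 * B)); rewrite -C0.
  suff -> : 2 * 1 * (- (A + 1) / (2 * B)) * B = - (A + 1) by lra.
  by field.
- have := h C (- B).
  have -> : C ^+ 2 * A + 2 * C * - B * B + (- B) ^+ 2 * C = C * (A * C - B ^+ 2).
    by ring.
  by rewrite pmulr_rge0// subr_ge0.
Qed.

Lemma rVpoly_sum (R : nzRingType) n (v : 'rV[R]_n) :
  rVpoly v = \sum_(i < n) v 0 i *: 'X^i.
Proof.
rewrite /rVpoly poly_def; apply: eq_bigr => i _; rewrite insubT//= => ltin.
by congr (v 0 _ *: _); apply: val_inj.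
Qed.

Section Functional.
Context {R : realType}.
Implicit Types (L : {scalar {poly R}}) (u p q r : {poly R}).

(** Semidefiniteness of the localizing Hankel matrix of order [d] for the weight [u], without
    coordinates; [size p <= d] means degree below [d]. *)
Definition psd_form L u d := forall p, (size p <= d)%N -> 0 <= L (u * p ^+ 2).

Lemma psd_formS L u d e : (e <= d)%N -> psd_form L u d -> psd_form L u e.
Proof. by move=> ed h p pe; apply: h; apply: leq_trans ed. Qed.

Lemma form_sqrD L u x y p q : L (u * (x *: p + y *: q) ^+ 2) =
  x ^+ 2 * L (u * p ^+ 2) + 2 * x * y * L (u * (p * q)) + y ^+ 2 * L (u * q ^+ 2).
Proof.
rewrite -!linearZ/= -!linearD/=; congr (L _).
by rewrite -!mul_polyC; ring.
Qed.

Lemma form_CauchySchwarz L u d p q : psd_form L u d ->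
  (size p <= d)%N -> (size q <= d)%N ->
  L (u * (p * q)) ^+ 2 <= L (u * p ^+ 2) * L (u * q ^+ 2).
Proof.
move=> h pd qd; apply: discr_le0 => x y; rewrite -form_sqrD; apply: h.
apply: leq_trans (size_polyD _ _) _; rewrite geq_max.
by rewrite !(leq_trans (size_scale_leq _ _)).
Qed.

Lemma form_isotropic L u d p q : psd_form L u d ->
  (size p <= d)%N -> (size q <= d)%N ->
  L (u * p ^+ 2) = 0 -> L (u * (p * q)) = 0.
Proof.
move=> h pd qd p0; have := form_CauchySchwarz h pd qd; rewrite p0 mul0r.
by move=> le0; apply/eqP; rewrite -sqrf_eq0 eq_le le0 sqr_ge0.
Qed.

(** Orthogonality to all lower degrees is a linear system for the Gram matrix. That matrix may be
    singular; the hypothesis, that its kernel is also orthogonal to ['X^d], is the solvability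
    condition. *)
Lemma exists_orthogonal L u d :
  (forall p, (size p <= d)%N ->
     (forall r, (size r <= d)%N -> L (u * (p * r)) = 0) ->
     L (u * (p * 'X^d)) = 0) ->
  exists2 q, q \is monic /\ size q = d.+1 &
    forall p, (size p <= d)%N -> L (u * (q * p)) = 0.
Proof.
move=> h.
pose M : 'M[R]_d := \matrix_(i, j) L (u * 'X^(i + j)).
pose b : 'rV[R]_d := \row_i L (u * 'X^(i + d)).
have ME (v : 'rV[R]_d) (k : nat) :
    L (u * (rVpoly v * 'X^k)) = \sum_(i < d) v 0 i * L (u * 'X^(i + k)).
  rewrite rVpoly_sum mulr_suml mulr_sumr linear_sum; apply: eq_bigr => i _.
  by rewrite -linearZ/=; congr (L _); rewrite -!mul_polyC exprD; ring.
(* Membership in the row space is tested against [cokermx M], whose columns, read as polynomials,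
   lie in the kernel of the form. *)
have /submxP[v bE] : (b <= M)%MS.
  rewrite submxE; apply/eqP/rowP => k; rewrite [RHS]mxE.
  pose c := (col k (cokermx M))^T.
  have Mc : M *m c^T = 0.
    by rewrite trmxK colE mulmxA mulmx_coker mul0mx.
  have -> : (b *m cokermx M) 0 k = L (u * (rVpoly c * 'X^d)).
    by rewrite ME mxE; apply: eq_bigr => i _; rewrite !mxE mulrC.
  apply: h => [|r rd]; first exact: size_poly.
  have -> : r = \poly_(i < d) r`_i.
    apply/polyP => i; rewrite coef_poly; case: ltnP => // ni.
    by rewrite nth_default// (leq_trans rd).
  rewrite poly_def !mulr_sumr linear_sum big1// => i _.
  rewrite -!scalerAr linearZ/= ME.
  have /matrixP/(_ i 0) := Mc; rewrite !mxE => Mc0.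
  rewrite (_ : \sum_(_ < d) _ = 0) ?mulr0// -[RHS]Mc0; apply: eq_bigr => j _.
  by rewrite !mxE mulrC addnC.
exists ('X^d - rVpoly v).
  have sv : (size (- rVpoly v) < size ('X^d : {poly R}))%N.
    by rewrite size_polyN size_polyXn ltnS size_poly.
  split; first by rewrite monicE lead_coefDl// lead_coefXn.
  by rewrite size_polyDl// size_polyXn.
move=> p pd.
have -> : p = \poly_(i < d) p`_i.
  apply/polyP => i; rewrite coef_poly; case: ltnP => // ni.
  by rewrite nth_default// (leq_trans pd).
rewrite poly_def !mulr_sumr linear_sum big1// => i _.
rewrite -!scalerAr linearZ/= mulrBl mulrBr linearB/= ME.
have /rowP/(_ i) := bE; rewrite !mxE addnC exprD => ->.
by under eq_bigr do rewrite mxE; rewrite subrr mulr0.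
Qed.

End Functional.

(** * Quadrature *)

(** The polynomial splits over the complex numbers, and a root [x +i* y] with [y != 0] would make
    its real quadratic divide [q]. *)
Lemma real_root_split (R : rcfType) (q : {poly R}) :
  (forall (x y : R) (g : {poly R}), y != 0 -> q != (('X - x%:P) ^+ 2 + (y ^+ 2)%:P) * g) ->
  exists s : seq R, q = lead_coef q *: \prod_(t <- s) ('X - t%:P).
Proof.
move=> noquad; have [->|q0] := eqVneq q 0.
  by exists [::]; rewrite lead_coef0 scale0r.
pose f := @real_complex R.
have [r qr] := closed_field_poly_normal (map_poly f q).
have r_real z : z \in r -> z = f (complex.Re z).
  move=> zr; have : root (map_poly f q) z.
    by rewrite qr rootZ ?lead_coef_eq0 ?map_poly_eq0// root_prod_XsubC.
  case: z zr => x y zr; rewrite /root => /eqP qz.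
  have [->//|y0] := eqVneq y 0.
  pose d := ('X - x%:P) ^+ 2 + (y ^+ 2)%:P.
  have sd : size d = 3.
    rewrite /d size_polyDl ?size_exp_XsubC//.
    by rewrite (leq_ltn_trans (size_polyC_leq1 _)).
  have dz : (map_poly f d).[(x +i* y)%C] = 0.
    rewrite /d rmorphD/= rmorphXn/= rmorphB/= map_polyX !map_polyC/=.
    rewrite !hornerE/= /f/=; simpc; apply/eqP; rewrite eq_complex/=.
    by apply/andP; split; apply/eqP; ring.
  have d0 : d != 0 by rewrite -size_poly_eq0 sd.
  have := divp_eq q d; set e := q %% d => qE.
  have se : (size e <= 2)%N by have := ltn_modp q d; rewrite d0 sd ltnS.
  have e01 : e = (e`_0)%:P + e`_1 *: 'X.
    apply/polyP => -[|[|i]]; rewrite coefD coefC coefZ coefX/= ?mulr0 ?mulr1 ?addr0 ?add0r//.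
    by rewrite nth_default// (leq_trans se).
  have ez : (map_poly f e).[(x +i* y)%C] = 0.
    by move: qz; rewrite qE rmorphD rmorphM/= hornerD hornerM dz mulr0 add0r.
  (* A real polynomial of degree at most one that vanishes at a non-real point is zero. *)
  have : e`_0 = 0 /\ e`_1 = 0.
    move: ez; rewrite {1}e01 rmorphD/= map_polyC map_polyZ map_polyX !hornerE/= /f/=.
    simpc => /eqP; rewrite eq_complex/= => /andP[/eqP e0 /eqP].
    rewrite ?add0r ?addr0 => /eqP; rewrite mulf_eq0 (negPf y0) orbF => /eqP e1.
    by move: e0; rewrite e1 mul0r ?subr0 ?addr0.
  move=> [e0 e1]; have := noquad x y (q %/ d) y0.
  by rewrite -/d mulrC {1}qE e01 e0 e1 scale0r !addr0 eqxx.
exists (map (@complex.Re R) r); apply: (@map_poly_inj _ _ f).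
rewrite map_polyZ rmorph_prod/= [LHS]qr lead_coef_map; congr (_ *: _).
rewrite big_map !big_seq; apply: eq_bigr => z zr.
by rewrite rmorphB/= map_polyX map_polyC/= {1}(r_real z zr).
Qed.

Lemma functional_XsubC (R : realType) (L : {scalar {poly R}}) c p :
  L (('X - c%:P) * p) = L ('X * p) - c * L p.
Proof. by rewrite mulrBl linearB/= mul_polyC linearZ. Qed.

Lemma functional_CsubX (R : realType) (L : {scalar {poly R}}) c p :
  L ((c%:P - 'X) * p) = c * L p - L ('X * p).
Proof. by rewrite mulrBl linearB/= mul_polyC linearZ. Qed.

(* [size_mul], stated over the ring structure through which the other sizes are
   elaborated; [lia] identifies them only up to syntax. *)
Lemma size_mul_poly (R : realType) (p q : {poly R}) : p != 0 -> q != 0 ->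
  size (p * q)%R = (size p + size q).-1.
Proof. exact: size_mul. Qed.

Section Quadrature.
Context {R : realType}.
Implicit Types p q r g d : {poly R}.
Variables (L : {scalar {poly R}}) (a b : R) (m : nat).
Hypotheses (ab : a < b) (La : psd_form L ('X - a%:P) m.+1)
  (Lb : psd_form L (b%:P - 'X) m.+1).

Lemma form_range p : (size p <= m.+1)%N ->
  a * L (p ^+ 2) <= L ('X * p ^+ 2) <= b * L (p ^+ 2).
Proof.
move=> pm; have := La pm; have := Lb pm; rewrite functional_XsubC functional_CsubX.
by move=> h1 h2; apply/andP; split; lra.
Qed.

(** The two weights add up to the positive constant [b - a]. *)
Lemma form_ge0 : psd_form L 1 m.+1.
Proof.
move=> p pm; rewrite mul1r; have /andP[h1 h2] := form_range pm.
have : 0 <= (b - a) * L (p ^+ 2) by lra.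
by rewrite pmulr_rge0// subr_gt0.
Qed.

(** By [form_range], [p] is isotropic for the weight ['X - a%:P] as well, so Cauchy-Schwarz applies
    to both forms. *)
Lemma isotropic_mulX p r : (size p <= m.+1)%N -> (size r <= m.+1)%N ->
  L (p ^+ 2) = 0 -> L ('X * (p * r)) = 0.
Proof.
move=> pm rm p0.
have Xp0 : L (('X - a%:P) * p ^+ 2) = 0.
  by have := form_range pm; rewrite functional_XsubC p0; lra.
have := form_isotropic La pm rm Xp0; rewrite functional_XsubC.
have := @form_isotropic _ _ _ _ p r form_ge0 pm rm.
rewrite !mul1r => ->//; lra.
Qed.

Lemma isotropic_mulXn p k : p != 0 -> (size p + k <= m.+1)%N ->
  L (p ^+ 2) = 0 -> L ((p * 'X^k) ^+ 2) = 0.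
Proof.
move=> p0 + Lp; elim: k => [|k IH] pk; first by rewrite expr0 mulr1.
have -> : (p * 'X^(k.+1)) ^+ 2 = 'X * ((p * 'X^k) * (p * 'X^(k.+1))).
  by rewrite (exprS _ k); ring.
apply: isotropic_mulX; rewrite ?size_mulXn//; first lia; first lia.
by apply: IH; lia.
Qed.

(** Cauchy-Schwarz settles the monomials of [p] of degree at most [m]. For higher ones the excess
    power of ['X] is moved onto [q], which stays isotropic; this reaches every moment up to order
    [2 * m + 1]. *)
Lemma isotropic_annihilates q p : q != 0 -> (size q <= m.+1)%N -> L (q ^+ 2) = 0 ->
  (size (q * p)%R <= 2 * m + 2)%N -> L (q * p) = 0.
Proof.
move=> q0 qm Lq; have [->|p0] := eqVneq p 0; first by rewrite mulr0 linear0.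
rewrite size_mul_poly// => pm.
have {}pm : (size p + size q <= 2 * m + 3)%N by lia.
have -> : p = \poly_(i < size p) p`_i by apply/polyP => i; rewrite coef_poly;
  case: ltnP => // /leq_sizeP->.
rewrite poly_def mulr_sumr linear_sum big1// => -[k kp] _ /=.
rewrite -scalerAr linearZ/=; suff -> : L (q * 'X^k) = 0 by rewrite mulr0.
have q1 : (0 < size q)%N by rewrite size_poly_gt0.
case: (leqP k m) => km.
  have := @form_isotropic _ _ _ _ q 'X^k form_ge0 qm.
  by rewrite !mul1r size_polyXn; apply.
have -> : q * 'X^k = 'X * ((q * 'X^(k - m.+1)) * 'X^m).
  by rewrite -{1}(subnKC km) exprD exprS; ring.
apply: isotropic_mulX; rewrite ?size_mulXn ?size_polyXn//; first lia.
by apply: isotropic_mulXn => //; lia.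
Qed.

(* [q] is the shortest isotropic polynomial of the form [L (p ^+ 2)], or the
   orthogonal polynomial of degree [m + 1] when the form is definite. *)
Lemma exists_node_poly : exists q,
  [/\ q != 0, (size q <= m.+2)%N,
      forall g : {poly R}, g != 0 -> (size g < size q)%N -> 0 < L (g ^+ 2) &
      forall p, (size (q * p)%R <= 2 * m + 2)%N -> L (q * p) = 0].
Proof.
have pos g : (size g <= m.+1)%N -> L (g ^+ 2) != 0 -> 0 < L (g ^+ 2).
  by move=> gm g0; rewrite lt_neqAle eq_sym g0/= -[_ ^+ 2]mul1r form_ge0.
pose P k := `[< exists2 g : {poly R}, g != 0 /\ size g = k & L (g ^+ 2) = 0 /\ (k <= m.+1)%N >].
have [exP|nexP] := pselect (exists k, P k).
  case: (ex_minnP exP) => k /asboolP[q [q0 sq] [Lq km]] kmin.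
  exists q; split => //; first by rewrite sq (leq_trans km).
    move=> g g0 gq; apply: pos; first by rewrite (leq_trans (ltnW gq))// sq.
    apply/negP => /eqP Lg; move: (gq); rewrite ltnNge sq => /negP; apply.
    apply: kmin; apply/asboolP; exists g => //; split => //.
    by rewrite -ltnS (leq_trans gq)// sq (leq_trans km).
  by move=> p; apply: isotropic_annihilates => //; rewrite sq.
have {}pos g : g != 0 -> (size g <= m.+1)%N -> 0 < L (g ^+ 2).
  move=> g0 gm; apply: pos => //; apply/negP => /eqP Lg; apply: nexP.
  by exists (size g); apply/asboolP; exists g.
(* No isotropic polynomial is left, so the kernel in the solvability condition is trivial. *)
have [|q [qmon sq] qorth] := @exists_orthogonal _ L 1 m.+1.
  move=> p pm h; have [->|p0] := eqVneq p 0; first by rewrite mul0r mulr0 linear0.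
  by have := pos _ p0 pm; rewrite expr2 -[p * p]mul1r h// ltxx.
have q0 := monic_neq0 qmon.
exists q; split => //.
- by rewrite sq.
- by move=> g g0 gq; apply: pos => //; rewrite -ltnS -sq.
move=> p; have [->|p0] := eqVneq p 0; first by rewrite mulr0 linear0.
rewrite size_mul_poly// sq => pm; rewrite -[q * p]mul1r qorth//; lia.
Qed.

(** The nodes are the roots of the polynomial [q] of [exists_node_poly]: positivity of [L] on
    squares of shorter polynomials makes them real and simple. The weights are the values of [L] at
    the Lagrange polynomials of the nodes. *)
Lemma gauss_quadrature : exists (s : seq R) (w : R -> R),
  [/\ forall t, t \in s -> a <= t <= b,
      forall t, t \in s -> 0 <= w t &
      forall p, (size p <= 2 * m + 2)%N -> L p = \sum_(t <- s) w t * p.[t]].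
Proof.
have [q [q0 sq qpos qL]] := exists_node_poly.
have size_factor d g : q = d * g -> [/\ d != 0, g != 0 & (size q).+1 = (size d + size g)%N].
  move=> qE; move: (q0); rewrite qE mulf_eq0 negb_or => /andP[d0 g0].
  by split => //; rewrite size_mul_poly// prednK// addn_gt0 size_poly_gt0 d0.
have sub_size g p k : (size g <= k)%N -> (size (p * g)%R <= (size p + k).-1)%N.
  by move=> gk; apply: leq_trans (size_polyMleq _ _) _; lia.
(* A quadratic factor with cofactor [g] would make [q * g] the sum of the squares of
   [('X - x%:P) * g] and [y *: g], both shorter than [q], against [L (q * g) = 0]. *)
have [|s qs] := @real_root_split _ q.
  move=> x y g y0; apply/eqP => qE.
  have sd : size (('X - x%:P) ^+ 2 + (y ^+ 2)%:P : {poly R}) = 3.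
    rewrite size_polyDl ?size_exp_XsubC//.
    by rewrite (leq_ltn_trans (size_polyC_leq1 _)).
  have [d0 g0 sz] := size_factor _ _ qE; rewrite sd in sz.
  have Lg : 0 < L (g ^+ 2) by apply: qpos => //; lia.
  have Lxg : 0 < L ((('X - x%:P) * g) ^+ 2).
    apply: qpos; first by rewrite mulf_neq0// polyXsubC_eq0.
    rewrite size_mul_poly// ?polyXsubC_eq0// size_XsubC; lia.
  have : L (q * g) = 0 by apply: qL; rewrite size_mul_poly//; lia.
  have -> : q * g = (('X - x%:P) * g) ^+ 2 + y ^+ 2 *: g ^+ 2.
    by rewrite qE -mul_polyC; ring.
  rewrite linearD linearZ/=; have : 0 < y ^+ 2 * L (g ^+ 2).
    by rewrite mulr_gt0// exprn_even_gt0.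
  lra.
have us : uniq s.
  (* A double root [t] with cofactor [g] would make [q * g] the square of [('X - t%:P) * g], again
     against [L (q * g) = 0]. *)
  apply/negPn/negP => /(uniqPn 0)[i [j [ij js sij]]].
  have [g qg] : exists g, q = ('X - (s`_i)%:P) ^+ 2 * g.
    exists (lead_coef q *: (\prod_(t <- take i s) ('X - t%:P) *
      \prod_(t <- take (j - i.+1) (drop i.+1 s)) ('X - t%:P) *
      \prod_(t <- drop j.+1 s) ('X - t%:P))).
    rewrite {1}qs -scalerAr; congr (_ *: _).
    rewrite -{1}[s](cat_take_drop i) big_cat (drop_nth 0) ?(ltn_trans ij)// big_cons.
    rewrite -{1}[drop i.+1 s](cat_take_drop (j - i.+1)) big_cat/=.
    by rewrite drop_drop subnK// (drop_nth 0 js) big_cons -sij; ring.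
  have [d0 g0 sz] := size_factor _ _ qg; rewrite size_exp_XsubC in sz.
  have : 0 < L ((('X - (s`_i)%:P) * g) ^+ 2).
    apply: qpos; first by rewrite mulf_neq0// polyXsubC_eq0.
    rewrite size_mul_poly// ?polyXsubC_eq0// size_XsubC; lia.
  have -> : (('X - (s`_i)%:P) * g) ^+ 2 = q * g by rewrite qg; ring.
  by rewrite qL ?ltxx// size_mul_poly//; lia.
have lq0 : lead_coef q != 0 by rewrite lead_coef_eq0.
have ssz : size q = (size s).+1.
  by rewrite qs size_scale// size_prod_XsubC.
have qfactor t : t \in s -> exists2 g : {poly R}, q = ('X - t%:P) * g & ~~ root g t.
  move=> ts; exists (lead_coef q *: \prod_(z <- rem t s) ('X - z%:P)).
    by rewrite {1}qs (big_rem t ts)/= -scalerAr.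
  by rewrite rootZ// root_prod_XsubC mem_rem_uniq// inE eqxx.
have [t|l lP] := @choice _ _ (fun t (l : {poly R}) => t \in s ->
    (size l <= size s)%N /\ forall z, z \in s -> l.[z] = (z == t)%:R).
  have [ts|] := boolP (t \in s); last by exists 0.
  have [g qg gt] := qfactor t ts.
  have [_ g0 sz] := size_factor _ _ qg; rewrite size_XsubC in sz.
  exists (g.[t]^-1 *: g) => _; split.
    by rewrite (leq_trans (size_scale_leq _ _))//; lia.
  move=> z zs; rewrite hornerZ; have [->|zt] := eqVneq z t; first by rewrite mulVf.
  have : root q z by rewrite qs rootZ// root_prod_XsubC.
  by rewrite qg rootM root_XsubC (negPf zt)/= => /eqP->; rewrite mulr0.
(* In the Euclidean division of [p] by [q], [L] kills the multiple of [q], and the remainder is its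
   own Lagrange interpolant. *)
have quad p : (size p <= 2 * m + 2)%N -> L p = \sum_(t <- s) L (l t) * p.[t].
  move=> pm; have := divp_eq p q; set r := p %% q => pE.
  have sr : (size r <= size s)%N by have := ltn_modp p q; rewrite q0 ssz ltnS.
  have pr t : t \in s -> p.[t] = r.[t].
    move=> ts; have : root q t by rewrite qs rootZ// root_prod_XsubC.
    by move=> /eqP qt; rewrite pE hornerD hornerM qt mulr0 add0r.
  have -> : L p = L r.
    rewrite {1}pE linearD/= mulrC qL ?add0r//.
    have -> : q * (p %/ q) = p - r by apply/esym/eqP; rewrite subr_eq mulrC -pE.
    rewrite (leq_trans (size_polyD _ _))// size_polyN geq_max pm (leq_trans sr)//; lia.
  have -> : r = \sum_(t <- s) r.[t] *: l t.
    apply/eqP; rewrite -subr_eq0; apply: contraT => d0.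
    suff : (size s < size s)%N by rewrite ltnn.
    apply: leq_trans (max_poly_roots d0 _ us) _; last first.
      rewrite (leq_trans (size_polyD _ _))// size_polyN geq_max sr/=.
      rewrite (leq_trans (size_sum _ _ _))//; apply/bigmax_leqP_seq => t ts _.
      by rewrite (leq_trans (size_scale_leq _ _))//; have [] := lP t ts.
    apply/allP => z zs; rewrite /root hornerD hornerN horner_sum.
    rewrite (bigD1_seq z)//= hornerZ (lP z zs).2// eqxx mulr1 big_seq_cond big1 ?addr0 ?subrr//.
    move=> t /andP[ts tz]; rewrite hornerZ (lP t ts).2// eq_sym.
    by rewrite (negPf tz) mulr0.
  rewrite linear_sum; rewrite !big_seq; apply: eq_bigr => t ts.
  by rewrite linearZ/= mulrC pr.
exists s, (fun t => L (l t)); split => // t ts.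
(* [L (q * g) = 0] reads [L ('X * g ^+ 2) = t * L (g ^+ 2)], so [form_range] locates [t]. *)
- have [g qg gt] := qfactor t ts.
  have [_ g0 sz] := size_factor _ _ qg; rewrite size_XsubC in sz.
  have sg : (size g < size q)%N by case: sz => ->.
  have Lg : 0 < L (g ^+ 2) by exact: qpos.
  have /form_range : (size g <= m.+1)%N by rewrite -ltnS (leq_trans sg).
  have : L (q * g) = 0 by apply: qL; rewrite size_mul_poly//; lia.
  rewrite qg -mulrA -expr2 functional_XsubC => /eqP.
  by rewrite subr_eq0 => /eqP->; rewrite !ler_pM2r.
(* [l t] and its square agree at the nodes, so the weight is [L (l t ^+ 2)]. *)
- have [sl lE] := lP t ts.
  have sm : (size (l t) <= m.+1)%N by rewrite (leq_trans sl)// -ltnS -ssz.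
  have := quad (l t ^+ 2); rewrite (bigD1_seq t)//= horner_exp lE// eqxx expr1n mulr1.
  rewrite big_seq_cond big1 ?addr0; last first.
    by move=> z /andP[zs zt]; rewrite horner_exp lE// (negPf zt) expr0n mulr0.
  move=> <-; first by rewrite -[_ ^+ 2]mul1r form_ge0.
  by rewrite expr2 (leq_trans (size_polyMleq _ _))//; lia.
Qed.

End Quadrature.

(** * Choice of the missing moment *)

Section Extension.
Context {R : realType}.
Implicit Types p q r f : {poly R}.

(* Among the admissible values of the missing moment of order [2 * m + 1] the
   least one is chosen; it makes [('X - a%:P) * q ^+ 2] isotropic for the
   orthogonal polynomial [q] of degree [m]. *)
Lemma psd_form_extension (L : {scalar {poly R}}) a b m : a < b ->
  psd_form L 1 m.+1 -> psd_form L (('X - a%:P) * (b%:P - 'X)) m ->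
  exists L' : {scalar {poly R}},
    [/\ forall p, (size p <= 2 * m + 1)%N -> L' p = L p,
        psd_form L' ('X - a%:P) m.+1 & psd_form L' (b%:P - 'X) m.+1].
Proof.
move=> ab L1 Lab; have {}L1 p : (size p <= m.+1)%N -> 0 <= L (p ^+ 2).
  by move=> pm; have := L1 p pm; rewrite mul1r.
pose u : {poly R} := 'X - a%:P.
have su p k : (size p <= k)%N -> (size (u * p)%R <= k.+1)%N.
  by move=> pk; rewrite (leq_trans (size_polyMleq _ _))// size_XsubC/= ltnS.
(* This is [u ^+ 2 = (b - a) *: u - u * (b%:P - 'X)]; it links the two given forms to the one of
   weight [u]. *)
have Luu p : L ((u * p) ^+ 2) = (b - a) * L (u * p ^+ 2) - L (u * (b%:P - 'X) * p ^+ 2).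
  rewrite -linearZ/= -linearB/=; congr (L _).
  by rewrite /u -mul_polyC polyCB; ring.
have La p : (size p <= m)%N -> 0 <= L (u * p ^+ 2).
  move=> pm; have := L1 (u * p) (su _ _ pm); have := Lab p pm; have := Luu p.
  rewrite -/u => -> h1 h2; have : 0 <= (b - a) * L (u * p ^+ 2) by lra.
  by rewrite pmulr_rge0// subr_gt0.
(* If [p] lies in the kernel for the weight [u], then [Luu] makes [L ((u * p) ^+ 2)] nonpositive; so
   [u * p] is isotropic for [L] and orthogonal to ['X^m]. *)
have [|q [qmon sq] qorth] := @exists_orthogonal _ L u m.
  move=> p pm h; have up0 : L ((u * p) ^+ 2) = 0.
    apply/eqP; rewrite eq_le (L1 _ (su _ _ pm)) andbT Luu expr2 h//.
    by have := Lab p pm; rewrite -/u expr2; lra.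
  have := @form_isotropic _ L 1 m.+1 (u * p) 'X^m; rewrite !mul1r -mulrA; apply=> //.
  - by move=> g gm; rewrite mul1r L1.
  - exact: su.
  - by rewrite size_polyXn.
(* The correction acts on the coefficient of order [2 * m + 1] only, which is the leading
   coefficient 1 of [u * q ^+ 2]. *)
pose d := - L (u * q ^+ 2).
pose L' : {scalar {poly R}} := L \+ d \*: coefp (2 * m + 1).
have L'E p : (size p <= 2 * m + 1)%N -> L' p = L p.
  by move=> pm; rewrite /L'/= nth_default// scaler0 addr0.
have sM p r k l : (size p <= k)%N -> (size r <= l)%N -> (size (p * r)%R <= (k + l).-1)%N.
  move=> pk rl; rewrite (leq_trans (size_polyMleq _ _))//.
  by rewrite -!subn1 leq_sub2r// leq_add.
have L'sq f : (size f <= m.+1)%N -> L' (f ^+ 2) = L (f ^+ 2).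
  move=> fm; apply: L'E; rewrite expr2 (leq_trans (sM _ _ _ _ fm fm))//; lia.
have L'u p r : (size p <= m)%N -> (size r <= m.+1)%N -> L' (u * (r * p)) = L (u * (r * p)).
  by move=> pm rm; apply: L'E; rewrite (leq_trans (su _ _ (sM _ _ _ _ rm pm)))//; lia.
have L'q : L' (u * q ^+ 2) = 0.
  have mon : u * q ^+ 2 \is monic by rewrite rpredM ?rpredX ?monicXsubC.
  have sz : size (u * q ^+ 2) = (2 * m + 2)%N.
    rewrite size_monicM ?monicXsubC ?expf_neq0 ?monic_neq0//.
    by rewrite size_XsubC expr2 size_monicM ?monic_neq0// sq; lia.
  have : lead_coef (u * q ^+ 2) = 1 by exact/monicP.
  rewrite lead_coefE sz (_ : (2 * m + 2).-1 = 2 * m + 1)%N; last by lia.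
  by rewrite /L'/= => ->; rewrite /d /GRing.scale/= mulr1 subrr.
clearbody L'.
have decomp f : (size f <= m.+1)%N ->
    exists x p, (size p <= m)%N /\ f = x *: q + 1 *: p.
  move=> fm; exists f`_m, (f - f`_m *: q); split; last by rewrite scale1r addrC subrK.
  apply/leq_sizeP => j; rewrite leq_eqVlt coefB coefZ => /orP[/eqP<-|mj].
    by have := monicP qmon; rewrite lead_coefE sq/= => ->; rewrite mulr1 subrr.
  by rewrite (nth_default 0 (leq_trans fm mj)) (@nth_default _ 0 q) ?sq// mulr0 subrr.
have L'f x p : (size p <= m)%N -> L' (u * (x *: q + 1 *: p) ^+ 2) = L (u * p ^+ 2).
  move=> pm; rewrite form_sqrD L'q L'u// ?sq// qorth//.
  by rewrite expr2 L'u ?(leqW pm)// -expr2; ring.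
have L'a : psd_form L' u m.+1.
  by move=> f /decomp[x [p [pm ->]]]; rewrite L'f// La.
exists L'; split => // f fm.
have [x [p [pm fE]]] := decomp f fm.
have -> : L' ((b%:P - 'X) * f ^+ 2) = (b - a) * L' (f ^+ 2) - L' (u * f ^+ 2).
  rewrite -linearZ/= -linearB/=; congr (L' _).
  by rewrite /u -mul_polyC polyCB; ring.
rewrite L'sq//= {2}fE L'f//.
have LA := La p pm; have LB := L1 f fm.
have LD : L ((u * p) ^+ 2) <= (b - a) * L (u * p ^+ 2).
  by rewrite Luu; have := Lab p pm; rewrite -/u; lra.
(* Orthogonality turns [L (u * p * f)] into [L (u * p ^+ 2)]. Cauchy-Schwarz and [LD] bound its
   square by [(b - a) * L (u * p ^+ 2) * L (f ^+ 2)], and one factor [L (u * p ^+ 2)] cancels unless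
   it is zero. *)
have := @form_CauchySchwarz _ L 1 m.+1 (u * p) f.
rewrite !mul1r (su _ _ pm) => /(_ _ isT fm).
have -> : L (u * p * f) = L (u * p ^+ 2).
  rewrite fE (_ : u * p * _ = x *: (u * (q * p)) + u * p ^+ 2); last first.
    by rewrite -!mul_polyC; ring.
  by rewrite linearD linearZ/= qorth// mulr0 add0r.
have psd1 : psd_form L 1 m.+1 by move=> g gm; rewrite mul1r L1.
move=> /(_ psd1) CS.
move: LA; rewrite le_eqVlt => /orP[/eqP<-|LA].
  by rewrite subr0 mulr_ge0// subr_ge0 ltW.
rewrite subr_ge0 -(ler_pM2l LA) -expr2 (le_trans CS)//.
rewrite mulrCA mulrA; exact: ler_wpM2r.
Qed.

End Extension.

(** * Comparison of positive semidefinite matrices *)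

Section PsdMatrix.
Context {R : realType}.

Lemma mx11_form_sym n (A : 'M[R]_n) (v w : 'rV[R]_n) : A^T = A ->
  (w *m A *m v^T) 0 0 = (v *m A *m w^T) 0 0.
Proof.
move=> symA; have -> : w *m A *m v^T = (v *m A *m w^T)^T.
  by rewrite !trmx_mul trmxK symA mulmxA.
by rewrite mxE.
Qed.

Lemma psd_CauchySchwarz n (A : 'M[R]_n) (v w : 'rV[R]_n) : possemidef A ->
  ((v *m A *m w^T) 0 0) ^+ 2 <= (v *m A *m v^T) 0 0 * (w *m A *m w^T) 0 0.
Proof.
move=> [symA psdA]; apply: discr_le0 => x y.
have := psdA (x *: v + y *: w).
rewrite linearD !linearZ/= !mulmxDl !mulmxDr -!scalemxAl -!scalemxAr.
have mxD (M N : 'M[R]_1) : (M + N) 0 0 = M 0 0 + N 0 0 by rewrite mxE.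
have mxZ c (M : 'M[R]_1) : (c *: M) 0 0 = c * M 0 0 by rewrite mxE.
rewrite !mxD !mxZ (mx11_form_sym v w symA); lra.
Qed.

Lemma psd_isotropic n (A : 'M[R]_n) (v : 'rV[R]_n) : possemidef A ->
  (v *m A *m v^T) 0 0 = 0 -> v *m A = 0.
Proof.
move=> psdA v0; apply/rowP => i; rewrite [RHS]mxE.
have := psd_CauchySchwarz v (delta_mx 0 i) psdA; rewrite v0 mul0r trmx_delta -colE mxE.
by move=> le0; apply/eqP; rewrite -sqrf_eq0 eq_le le0 sqr_ge0.
Qed.

Lemma psd_entry_le n (A : 'M[R]_n) (v : 'rV[R]_n) i : possemidef A ->
  (v *m A) 0 i ^+ 2 <= (v *m A *m v^T) 0 0 * A i i.
Proof.
move=> psdA; have := psd_CauchySchwarz v (delta_mx 0 i) psdA.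
by rewrite trmx_delta -colE mxE -rowE -colE !mxE.
Qed.

(* Since the rows of [B] lie in the row space of [A], [B = A *m W *m A] for
   some [W], and the entries of [v *m A] are controlled by the form of [A]. *)
Lemma psd_compare n (A B : 'M[R]_n) : possemidef A -> possemidef B ->
  (forall v : 'rV_n, (v *m A *m v^T) 0 0 = 0 -> (v *m B *m v^T) 0 0 = 0) ->
  exists2 c : R, 0 < c &
    forall v : 'rV_n, c * (v *m B *m v^T) 0 0 <= (v *m A *m v^T) 0 0.
Proof.
move=> psdA psdB kerAB; have [symA _] := psdA; have [symB _] := psdB.
have BA : (B <= A)%MS.
  (* The columns of [cokermx A] are isotropic for [A], hence for [B], and a semidefinite matrix
     kills its isotropic vectors. *)
  rewrite submxE; apply/eqP/trmx_inj; rewrite trmx0; apply/row_matrixP => i.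
  rewrite row0 trmx_mul symB row_mul; apply: psd_isotropic => //.
  apply: kerAB; rewrite -[X in _ *m X *m _]symA -row_mul -trmx_mul mulmx_coker trmx0 row0.
  by rewrite mul0mx mxE.
have [P BP] : exists P, B *m P *m A = B by exists (pinvmx A); exact: mulmxKpV.
have PB : A *m P^T *m B = B.
  by rewrite -[RHS]symB -[in RHS]BP !trmx_mul symA symB mulmxA.
pose W := P^T *m (B *m P).
have BE : B = A *m W *m A by rewrite /W !mulmxA PB BP.
(* With [y = v *m A], a product of two entries of [y] is at most the sum of their squares, and
   [psd_entry_le] bounds each square by the form of [A] times a diagonal entry. *)
pose C := \sum_i \sum_j `|W j i| * (A j j + A i i).
have A0 i : 0 <= A i i.
  by have := psdA.2 (delta_mx 0 i); rewrite trmx_delta -rowE -colE !mxE.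
have C0 : 0 <= C.
  by apply: sumr_ge0 => i _; apply: sumr_ge0 => j _; rewrite mulr_ge0// addr_ge0.
exists (C + 1)^-1; first by rewrite invr_gt0 ltr_wpDl.
move=> v; rewrite ler_pdivrMl ?ltr_wpDl//; set Q := (v *m A *m v^T) 0 0.
have Q0 : 0 <= Q by exact: psdA.2.
suff : (v *m B *m v^T) 0 0 <= C * Q by lra.
pose y := v *m A.
have -> : v *m B *m v^T = y *m W *m y^T by rewrite BE /y trmx_mul symA !mulmxA.
have yA i : y 0 i ^+ 2 <= Q * A i i by exact: psd_entry_le.
clearbody y; rewrite mxE /C mulr_suml; apply: ler_sum => i _.
rewrite !mxE mulr_suml mulr_suml; apply: ler_sum => j _.
have := yA i; have := yA j; move: (y 0 i) (y 0 j) => s t hs ht.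
rewrite (le_trans (ler_norm _))// !normrM mulrAC mulrC -mulrA ler_wpM2l//.
have : `|t| * `|s| <= `|s| ^+ 2 + `|t| ^+ 2.
  by have := sqr_ge0 (`|s| - `|t|); nra.
by rewrite !real_normK ?num_real//; lra.
Qed.
End PsdMatrix.

(** * Hankel matrices as quadratic forms on polynomials *)

Section HankelForm.
Context {R : realType} (L : {scalar {poly R}}) (u : {poly R}).

Lemma hankel_formE n (M : 'M[R]_n) (v : 'rV[R]_n) :
  (forall i j : 'I_n, M i j = L (u * 'X^(i + j))) ->
  (v *m M *m v^T) 0 0 = L (u * rVpoly v ^+ 2).
Proof.
move=> ME; rewrite mxE expr2 rVpoly_sum mulr_suml mulr_sumr linear_sum.
under eq_bigr do rewrite !mxE mulr_suml.
rewrite exchange_big/=; apply: eq_bigr => i _; rewrite mulr_sumr mulr_sumr linear_sum.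
apply: eq_bigr => j _; rewrite ME -!scalerAl -!scalerAr !linearZ/= exprD.
by rewrite /GRing.scale/= mulrC -mulrA.
Qed.

Lemma hankel_psd n (M : 'M[R]_n) :
  (forall i j : 'I_n, M i j = L (u * 'X^(i + j))) ->
  possemidef M <-> psd_form L u n.
Proof.
move=> ME; split=> [[_ h] p pn|h].
  by have := h (poly_rV p); rewrite (hankel_formE _ ME) poly_rV_K.
split; first by apply/matrixP => i j; rewrite mxE !ME addnC.
by move=> v; rewrite (hankel_formE _ ME) h// size_poly.
Qed.

End HankelForm.

(** * Moments and gaps *)

Lemma bin_mul_bin n j k : (k <= j)%N -> (j <= n)%N ->
  ('C(n, j) * 'C(j, k) = 'C(n, k) * 'C(n - k, j - k))%N.
Proof.
move=> kj jn; have kn := leq_trans kj jn.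
apply/eqP; rewrite -(@eqn_pmul2r (k`! * (j - k)`! * (n - j)`!)); last first.
  by rewrite !muln_gt0 !fact_gt0.
have := bin_fact jn; have := bin_fact kj; have := bin_fact kn.
have := @bin_fact (n - k) (j - k); rewrite leq_sub2r// => /(_ isT).
rewrite (_ : n - k - (j - k) = n - j)%N; last by lia.
move=> E1 E2 E3 E4; apply/eqP; transitivity n`!.
  by rewrite -E4 -E3; ring.
by rewrite -E2 -E1; ring.
Qed.

Section GapMoments.
Context {R : realType}.

(** Correcting one coefficient at a time realizes any finite list of moments. Sufficiency starts
    from such a functional, before any measure is known. *)
Lemma exists_functional (s : nat -> R) N :
  exists L : {scalar {poly R}}, forall k, (k < N)%N -> L 'X^k = s k.
Proof.
elim: N => [|N [L LE]]; first by exists (0 \*: coefp 0).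
exists (L \+ (s N - L 'X^N) \*: coefp N) => k.
rewrite ltnS leq_eqVlt => /orP[/eqP->|kN] /=; rewrite /GRing.scale/= coefXn.
  by rewrite eqxx mulr1 addrC subrK.
by rewrite gtn_eqF// mulr0 addr0 LE.
Qed.

Definition gap_weight n j k : nat := (n - j) * 'C(j, k.+1).

(** Isolates the dependence on [j] as a binomial coefficient of the expansion in [sum_bernstein]. *)
Lemma gap_weight_bin n j k : (k < j < n)%N ->
  (gap_weight n j k * 'C(n, j) = n * 'C(n.-1, k.+1) * 'C(n.-2 - k, j.-1 - k))%N.
Proof.
case: n j => [|n] [|j]; rewrite ?andbF// /gap_weight !ltnS => /andP[kj jn].
rewrite mulnAC -mul_bin_down -!mulnA bin_mul_bin//.
by rewrite !subSS -pred_Sn -[n.-1]subn1 -subnDA add1n.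
Qed.

(** For [0 < j < n], this is [t ^+ j * (1 - t) ^+ (n - j)] with the weight [t * (1 - t)] divided
    out. *)
Definition bernstein_mono n j : {poly R} := 'X^(j.-1) * (1 - 'X) ^+ (n.-1 - j).

Definition gaps_repr n (g : nat -> R) (L : {scalar {poly R}}) :=
  forall j, (0 < j < n)%N -> g j = 'C(n, j)%:R * L (bernstein_mono n j).

(** Binomial expansion of ['X^k * (1 - 'X + 'X) ^+ (n.-2 - k)]. *)
Lemma sum_bernstein n k : (k < n.-1)%N ->
  \sum_(k.+1 <= j < n) 'C(n.-2 - k, j.-1 - k)%:R *: bernstein_mono n j = 'X^k.
Proof.
move=> kn; rewrite -[k.+1]add0n big_addn big_mkord.
have -> : (n - k.+1 = (n.-2 - k).+1)%N by lia.
transitivity ('X^k * (1 - 'X + 'X) ^+ (n.-2 - k) : {poly R}); last first.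
  by rewrite subrK expr1n mulr1.
rewrite exprDn mulr_sumr.
apply: eq_bigr => i _; rewrite /bernstein_mono.
have -> : (i + k.+1).-1 = (k + i)%N by lia.
have -> : (n.-1 - (i + k.+1) = n.-2 - k - i)%N by lia.
by rewrite addKn exprD scaler_nat mulrnAr; congr (_ *+ _); ring.
Qed.

Lemma gaps_repr_sum n g (L : {scalar {poly R}}) k : gaps_repr n g L -> (k < n.-1)%N ->
  \sum_(k.+1 <= j < n) (gap_weight n j k)%:R * g j =
  n%:R * 'C(n.-1, k.+1)%:R * L 'X^k.
Proof.
move=> gL kn; rewrite -(sum_bernstein kn) linear_sum mulr_sumr.
apply: eq_big_nat => j kj; rewrite gL; last by lia.
by rewrite mulrA -(natrM _ (gap_weight _ _ _)) gap_weight_bin// linearZ/= !natrM -!mulrA.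
Qed.

(** The system is triangular with diagonal entries [n - j], and is solved downwards from
    [j = n - 1]. *)
Lemma gap_weight_inj n (g : nat -> R) :
  (forall k, (k < n.-1)%N ->
     \sum_(k.+1 <= j < n) (gap_weight n j k)%:R * g j = 0) ->
  forall j, (0 < j < n)%N -> g j = 0.
Proof.
move=> h j; have [d] := ubnP (n - j); elim: d j => // d IH j jd jn.
have := h j.-1; rewrite prednK; last by case/andP: jn.
move=> /(_ ltac:(lia)); rewrite big_ltn; last by case/andP: jn.
rewrite big1_seq ?addr0; last first.
  move=> i; rewrite mem_index_iota => /andP[_ ij].
  by rewrite IH ?mulr0//; lia.
move=> /eqP; rewrite mulf_eq0 pnatr_eq0 => /orP[|/eqP//].
rewrite /gap_weight prednK; last by case/andP: jn.
by rewrite binn muln1 subn_eq0; lia.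
Qed.

Variables (n : nat) (beta : n.-tuple R).

Lemma lam_sum : lam beta = \sum_(1 <= j < n) (gap_weight n j 0)%:R * gap beta j.
Proof. by apply: eq_bigr => j _; rewrite /gap_weight bin1 mulnC. Qed.

Lemma nuE k : nu beta k = n.-1%:R / (lam beta * 'C(n.-1, k.+1)%:R) *
  \sum_(k.+1 <= j < n) (gap_weight n j k)%:R * gap beta j.
Proof. by []. Qed.

Lemma gap_gt0 j : sorted <%R beta -> (0 < j < n)%N -> 0 < gap beta j.
Proof.
move=> sb /andP[j0 jn]; rewrite subr_gt0.
have := @sorted_ltn_nth _ _ lt_trans 0 beta sb j.-1 j.
by rewrite !inE size_tuple => -> //; lia.
Qed.

Lemma lam_gt0 : (1 < n)%N -> sorted <%R beta -> 0 < lam beta.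
Proof.
move=> n1 sb; rewrite lam_sum big_ltn// ltr_pwDl//.
  rewrite mulr_gt0 ?gap_gt0// ltr0n muln_gt0 subn_gt0 n1 bin1//.
rewrite big_nat_cond sumr_ge0// => j /andP[jn _].
by rewrite mulr_ge0 ?ler0n// ltW// gap_gt0//; lia.
Qed.

Lemma nu_repr (L : {scalar {poly R}}) : (1 < n)%N -> sorted <%R beta -> gaps_repr n (gap beta) L ->
  exists2 c : R, 0 < c & forall k, (k < n.-1)%N -> nu beta k = c * L 'X^k.
Proof.
move=> n1 sb gL; have l0 := lam_gt0 n1 sb.
exists (n.-1%:R * n%:R / lam beta).
  by rewrite divr_gt0// mulr_gt0// ltr0n; lia.
move=> k kn; rewrite nuE (gaps_repr_sum gL kn).
have : 'C(n.-1, k.+1)%:R != 0 :> R by rewrite pnatr_eq0 -lt0n bin_gt0.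
by move=> ?; field; rewrite gt_eqF.
Qed.

(** The gaps defined by the rescaled functional have the same weighted sums as those of [beta], so
    [gap_weight_inj] kills the difference. The scalar undoes the normalization in [nu]. *)
Lemma gaps_repr_nu (L : {scalar {poly R}}) : (1 < n)%N -> sorted <%R beta ->
  (forall k, (k < n.-1)%N -> nu beta k = L 'X^k) ->
  gaps_repr n (gap beta) ((lam beta / (n.-1%:R * n%:R)) \*: L).
Proof.
move=> n1 sb nuL; have l0 := lam_gt0 n1 sb; set L' := _ \*: L.
pose g j := 'C(n, j)%:R * L' (bernstein_mono n j).
have gL : gaps_repr n g L' by [].
move=> j jn; apply/eqP; rewrite -subr_eq0; apply/eqP.
apply: (gap_weight_inj (g := fun j => gap beta j - g j)) jn => k kn.
under eq_bigr do rewrite mulrBr.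
rewrite sumrB (gaps_repr_sum gL kn).
have := nuL k kn; rewrite nuE.
have C0 : 'C(n.-1, k.+1)%:R != 0 :> R by rewrite pnatr_eq0 -lt0n bin_gt0.
have n0 : n%:R != 0 :> R by rewrite pnatr_eq0; lia.
have n10 : n.-1%:R != 0 :> R by rewrite pnatr_eq0; lia.
set S := \sum_(_ <= _ < _) _ => SE; rewrite /L'/= -SE /GRing.scale/=.
by field; rewrite C0 n0 n10 gt_eqF.
Qed.

End GapMoments.

(** * Order statistics *)

Lemma nth_le_count disp (T : orderType disp) (x0 x : T) (s : seq T) k :
  sorted <=%O s -> (k < size s)%N ->
  (nth x0 s k <= x)%O = (k < count (fun y => (y <= x)%O) s)%N.
Proof.
elim: s k => // y s IH k /= ys ks.
have /allP ymin := order_path_min le_trans ys.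
have [yx|xy] := leP y x.
  by case: k ks => [|k] //= ks; rewrite IH// (path_sorted ys).
have /eqP : count (fun z => (z <= x)%O) s = 0%N.
  by apply/eqP; rewrite -leqn0 leqNgt -has_count; apply/hasPn => z /ymin yz;
     rewrite -ltNge (lt_le_trans xy).
move=> /eqP->; rewrite ltn0; apply/negbTE; rewrite -ltNge.
by case: k ks => //= k ks; rewrite (lt_le_trans xy)// ymin// mem_nth.
Qed.

Section OrderStat.
Context {R : realType} {T : Type} {n : nat}.
Implicit Types (X : 'I_n -> T -> R) (w : T).

Lemma order_stat_le X k w x :
  (order_stat X k w <= x) = (k < #|[set i | (X i w <= x)%R]%SET|)%N.
Proof.
rewrite /order_stat nth_le_count ?sort_le_sorted//; last first.
  by rewrite size_sort size_map size_enum_ord.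
congr (_ < _)%N; have /permP-> : perm_eq (sort <=%R [seq X i w | i <- enum 'I_n])
  [seq X i w | i <- enum 'I_n] by rewrite perm_sort.
rewrite count_map cardsE cardE -size_filter; congr size.
by rewrite /enum_mem -filter_predI; apply: eq_filter => i; rewrite !inE andbT.
Qed.

Lemma order_stat_mono X w (j k : 'I_n) : (j <= k)%N ->
  order_stat X j w <= order_stat X k w.
Proof.
by move=> jk; rewrite order_stat_le (leq_ltn_trans jk)// -order_stat_le.
Qed.

End OrderStat.

Section IndependentCount.
Context {R : realType} d (T : measurableType d) (P : probability T R) (n : nat).

(** The event is split according to the set [J] of indices falling in [B]. Independence, applied to
    [B] on [J] and to its complement elsewhere, gives each piece the same probability. *)
Lemma prob_count (X : 'I_n -> {RV P >-> R}) (B : set R) (p : R) k :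
  mutually_independent X -> measurable B ->
  (forall i, P (X i @^-1` B)%classic = p%:E) ->
  P [set w | #|[set i | X i w \in B]%SET| = k]%classic =
  ('C(n, k)%:R * (p ^+ k * (1 - p) ^+ (n - k)))%:E.
Proof.
move=> indX mB XB.
pose C (J : {set 'I_n}) i := (if i \in J then B else ~` B)%classic.
have mC J i : measurable (C J i) by rewrite /C; case: ifP => // _; exact: measurableC.
pose E J := (\bigcap_(i in [set` [set: 'I_n]%SET]) (X i @^-1` C J i))%classic.
have EP J w : E J w <-> [set i | X i w \in B]%SET = J.
  split=> [h|<- i _].
    apply/setP => i; rewrite inE; have := h i; rewrite /= inE => /(_ isT).
    by rewrite /C; case: ifP => _ /=; [move=> ?; apply/mem_set | move=> ?; apply/memNset].
  rewrite /= /C inE; case: ifP; first by rewrite inE.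
  by move/negbT; rewrite notin_setE.
have mE J : measurable (E J).
  apply: fin_bigcap_measurable => [|i _]; first exact: finite_finset.
  by rewrite -[X in measurable X]setTI; apply: measurable_funP.
have PE (J : {set 'I_n}) : P (E J) = (p ^+ #|J| * (1 - p) ^+ (n - #|J|))%:E.
  rewrite /E (indX _ _ (mC J)).
  transitivity (\prod_(i < n) (if i \in J then p else 1 - p)%:E)%E.
    apply: eq_big => [i|i _]; first by rewrite inE.
    rewrite /C; case: ifP => _ //.
    by rewrite preimage_setC probability_setC ?XB// -[X in measurable X]setTI;
      apply: measurable_funP.
  rewrite prodEFin; congr EFin; rewrite (bigID (mem J))/=; congr (_ * _).
    by rewrite (eq_bigr (fun=> p)) ?prodr_const// => i ->.
  rewrite (eq_bigr (fun=> 1 - p)) ?prodr_const => [|i /negPf->//].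
  congr (_ ^+ _); have := cardsCs J; rewrite card_ord => ->.
  rewrite subKn; last by rewrite -[leqRHS](card_ord n) max_card.
  by apply: eq_card => i; rewrite !inE.
pose D := [set J : {set 'I_n} | #|J| == k]%SET.
have -> : [set w | #|[set i | X i w \in B]%SET| = k]%classic =
    (\bigcup_(J in [set` enum D]) E J)%classic.
  apply/seteqP; split=> w /=.
    by move=> wk; exists [set i | X i w \in B]%SET; [rewrite /= mem_enum inE wk | exact/EP].
  by move=> [J /=]; rewrite mem_enum inE => /eqP <- /EP->.
rewrite measure_fin_bigcup//; last first.
  by move=> I J _ _ [w [/EP <- /EP]].
rewrite -fsbig_seq ?enum_uniq// big_enum/=.
rewrite (eq_bigr (fun=> (p ^+ k * (1 - p) ^+ (n - k))%:E)) => [|J]; last first.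
  by rewrite inE PE => /eqP->.
by rewrite sumEFin sumr_const card_draws card_ord mulr_natl.
Qed.

End IndependentCount.

(** * Finitely supported laws and their i.i.d. samples *)

Section NatProbability.
Context {R : realType}.

Lemma measurable_fun_nat (f : nat -> R) : measurable_fun [set: nat]%classic f.
Proof. by []. Qed.

(** A named copy of [f] that carries the structure of a measurable function. *)
Definition nat_fun (f : nat -> R) := f.

HB.instance Definition _ (f : nat -> R) :=
  isMeasurableFun.Build _ _ _ _ (nat_fun f) (measurable_fun_nat f).

Variables (w : nat -> R) (N : nat).
Hypothesis w0 : forall k, 0 <= w k.

Definition atomic_measure : set nat -> \bar R :=
  msum (fun k => mscale (NngNum (w0 k)) (@dirac _ _ k R)) N.

HB.instance Definition _ := Measure.on atomic_measure.

Lemma atomic_measureE A :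
  atomic_measure A = (\sum_(k < N) w k * ((k : nat) \in A)%:R)%:E.
Proof.
rewrite /atomic_measure /msum -sumEFin; apply: eq_bigr => k _. by [].
Qed.

Lemma ge0_integral_atomic (f : nat -> R) : (forall k, 0 <= f k) ->
  (\int[atomic_measure]_k (f k)%:E = (\sum_(k < N) w k * f k)%:E)%E.
Proof.
move=> f0; rewrite /atomic_measure ge0_integral_measure_sum//; last first.
  by move=> k _; rewrite lee_fin.
rewrite -sumEFin; apply: eq_bigr => k _; rewrite ge0_integral_mscale//; last first.
  by move=> j _; rewrite lee_fin.
by rewrite integral_dirac// diracT mul1e.
Qed.

Lemma integrable_atomic (f : nat -> R) :
  atomic_measure.-integrable setT (EFin \o f).
Proof.
apply/integrableP; split => //; rewrite (eq_integral (fun k => `|f k|%:E))//.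
by rewrite ge0_integral_atomic// ltry.
Qed.

Hypothesis w1 : \sum_(k < N) w k = 1.

Lemma atomic_measureT : atomic_measure setT = 1%E.
Proof.
rewrite atomic_measureE -[RHS]/(1%:E) -[in RHS]w1; congr EFin; apply: eq_bigr => k _.
by rewrite mem_set// mulr1.
Qed.

Definition atomic_probability : probability nat R := HB.pack atomic_measure
  (Measure_isProbability.Build _ _ _ atomic_measure atomic_measureT).

Lemma expectation_atomic (f : nat -> R) :
  ('E_atomic_probability[f] = (\sum_(k < N) w k * f k)%:E)%E.
Proof.
(* Positive and negative parts, since [ge0_integral_atomic] requires a nonnegative integrand. *)
pose g k := Num.max (f k) 0; pose h k := Num.max (- f k) 0.
have fE k : f k = g k - h k.
  by rewrite /g /h; case: (leP (f k) 0) => fk; case: leP; lra.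
rewrite unlock (eq_integral (EFin \o (g \- h)))//; last first.
  by move=> k _ /=; rewrite fE.
rewrite integralB_EFin//; [|exact: integrable_atomic|exact: integrable_atomic].
rewrite !ge0_integral_atomic; [|by move=> k; rewrite /h le_max lexx orbT
  |by move=> k; rewrite /g le_max lexx orbT].
by rewrite -EFinB -sumrB; congr EFin; apply: eq_bigr => k _; rewrite fE mulrBr.
Qed.

End NatProbability.

(** The first points of [nat] enumerate the functions from ['I_n] to ['I_m.+1], weighted by products
    of [p]; distributing products over sums gives independence. The draws [D] come before [g], so
    that variables built from different [g] live on the same sample. *)
Lemma exists_iid (R : realType) (n m : nat) (p : 'I_m.+1 -> R) :
  (forall x, 0 <= p x) -> \sum_x p x = 1 ->
  exists (P : probability nat R) (D : nat -> 'I_n -> 'I_m.+1),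
  [/\ forall f : nat -> R, P.-integrable setT (EFin \o f),
      exists (w : nat -> R) N, forall f : nat -> R,
        ('E_P[f] = (\sum_(k < N) w k * f k)%:E)%E &
      forall g : 'I_m.+1 -> R, exists X : 'I_n -> {RV P >-> R},
      [/\ forall i w, X i w = g (D w i), mutually_independent X &
          forall i B, P (X i @^-1` B)%classic = (\sum_x p x * (g x \in B)%:R)%:E]].
Proof.
move=> p0 p1.
pose F := {ffun 'I_n -> 'I_m.+1}.
pose D (k : nat) : F := nth [ffun=> ord0] (enum F) k.
pose W (f : F) := \prod_i p (f i).
have sumD (h : F -> R) : \sum_(k < #|F|) h (D k) = \sum_f h f.
  by rewrite -[RHS]big_enum/= (big_nth [ffun=> ord0]) big_mkord -cardE.
have sumW (h : 'I_n -> 'I_m.+1 -> R) :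
    \sum_(k < #|F|) W (D k) * \prod_i h i (D k i) = \prod_i \sum_x p x * h i x.
  rewrite (sumD (fun f => W f * \prod_i h i (f i))) bigA_distr_bigA/=.
  by apply: eq_bigr => f _; rewrite -big_split.
have W0 k : 0 <= W (D k) by apply: prodr_ge0 => i _; exact: p0.
have W1 : \sum_(k < #|F|) W (D k) = 1.
  have := sumW (fun _ _ => 1); rewrite [RHS]big1; last first.
    by move=> i _; rewrite -[RHS]p1; apply: eq_bigr => x _; rewrite mulr1.
  by move=> <-; apply: eq_bigr => k _; rewrite big1// mulr1.
pose P := atomic_probability W0 W1.
have PA (A : set nat) : P A = (\sum_(k < #|F|) W (D k) * ((k : nat) \in A)%:R)%:E.
  exact: atomic_measureE.
exists P, D; split.
- exact: integrable_atomic.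
- by exists (fun k => W (D k)), #|F|; exact: expectation_atomic.
move=> g; pose X i : {RV P >-> R} := nat_fun (fun w => g (D w i)).
have PX (J : {set 'I_n}) (B : 'I_n -> set R) :
    P (\bigcap_(i in [set` J]) (X i @^-1` B i))%classic =
    (\prod_(i in J) \sum_x p x * (g x \in B i)%:R)%:E.
  pose h i x : R := if i \in J then (g x \in B i)%:R else 1.
  rewrite PA; congr EFin; rewrite [RHS]big_mkcond/=.
  transitivity (\prod_i \sum_x p x * h i x).
    rewrite -sumW; apply: eq_bigr => k _; congr (_ * _).
    rewrite /h -big_mkcond/=; case: (pselect (forall i, i \in J -> B i (g (D k i)))) => BJ.
      rewrite mem_set//= big1// => i iJ; rewrite mem_set//; exact: BJ.
    rewrite memNset//= ; have /existsNP[i /not_implyP[iJ Bi]] := BJ.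
    by rewrite (bigD1 i)//= memNset// mul0r.
  apply: eq_bigr => i _; rewrite /h; case: ifP => // _.
  by under eq_bigr do rewrite mulr1.
have PX1 i (B : set R) : P (X i @^-1` B)%classic = (\sum_x p x * (g x \in B)%:R)%:E.
  rewrite -(bigcap_set1 (fun i => X i @^-1` B)%classic i).
  have -> : [set i]%classic = [set` [set i]%SET]%classic.
    by apply/seteqP; split=> j /=; rewrite inE => /eqP.
  by rewrite PX big_set1.
exists X; split => // J B mB; rewrite PX -prodEFin; apply: eq_bigr => i _.
by rewrite PX1.
Qed.

(** Sorting commutes with a nondecreasing map, so [x] is the order statistic of the levels
    themselves. The type [unit] stands for one fixed outcome. *)
Lemma order_stat_homo (R : realType) n m (g : nat -> R) (D : 'I_n -> 'I_m) (k : 'I_n) :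
  {homo g : x y / (x <= y)%N >-> x <= y} ->
  exists2 x : nat, order_stat (fun i (_ : unit) => g (D i)) k tt = g x &
    forall y, (x <= y)%N = (k < #|[set i | (D i <= y)%N]%SET|)%N.
Proof.
move=> gmono; pose s := [seq (D i : nat) | i <- enum 'I_n].
have ss : size s = n by rewrite size_map size_enum_ord.
exists (nth 0%N (sort <=%O s) k).
  rewrite /order_stat -(nth_map 0%N 0) ?size_sort ?ss//; congr (nth _ _ _).
  apply: (@sorted_eq _ <=%R); [exact: le_trans|exact: le_anti| | |].
  - exact: sort_le_sorted.
  - apply: homo_sorted (sort_le_sorted _); exact: gmono.
  - rewrite perm_sort (map_comp g (fun i => D i : nat)); apply: perm_map.
    by rewrite perm_sym perm_sort.
move=> y; rewrite -leEnat nth_le_count ?sort_le_sorted ?size_sort ?ss//.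
congr (_ < _)%N; have /permP-> : perm_eq (sort <=%O s) s by rewrite perm_sort.
rewrite count_map cardsE cardE -size_filter; congr size.
by rewrite /enum_mem -filter_predI; apply: eq_filter => i; rewrite !inE andbT.
Qed.

(* [X = x0 + \sum_i l (s_i) * [K > i]], where the level [K] satisfies
   [P (K <= i) = s_i]: the distribution function of [X] is then constant, equal
   to [s_i], on an interval of length [l (s_i)]. *)
Lemma EOS_of_atoms (R : realType) n (beta : n.-tuple R) (s : seq R) (l : R -> R) :
  (1 < n)%N -> sorted <%R beta -> sorted <=%R s ->
  (forall t, t \in s -> 0 < t < 1) -> (forall t, t \in s -> 0 <= l t) ->
  (forall j, (0 < j < n)%N ->
     gap beta j = 'C(n, j)%:R * \sum_(t <- s) l t * (t ^+ j * (1 - t) ^+ (n - j))) ->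
  EOS beta.
Proof.
move=> n1 sb ss s01 l0 gapE; pose r := size s.
(* The values of the distribution function: [u 0 = 0], then the elements of [s], then the default 1
   at [r.+1]. The increments [p] are the law of the level. *)
pose u k := nth 1 (0 :: s) k; pose p (x : 'I_r.+1) := u x.+1 - u x.
have su (i : 'I_r) : u i.+1 \in s by rewrite /u/= mem_nth.
have p0 x : 0 <= p x.
  have : path <=%R 0 (rcons s 1).
    rewrite rcons_path; apply/andP; split.
      rewrite (path_sortedE le_trans) ss andbT.
      by apply/allP => t /s01 /andP[/ltW].
    have := mem_last 0 s; rewrite inE => /orP[/eqP->|]; first exact: ler01.
    by move=> /s01 /andP[_ /ltW].
  move=> /(pathP 1) /(_ x); rewrite size_rcons ltn_ord => /(_ isT).
  rewrite subr_ge0 /u/= -rcons_cons !nth_rcons.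
  case: x => [x xr] /=; rewrite -/r xr; move: xr.
  rewrite ltnS leq_eqVlt => /orP[/eqP->|->//].
  by rewrite ltnn eqxx [nth 1 s r]nth_default.
have pD k : (k <= r)%N -> \sum_(x < r.+1) p x * (x <= k)%N%:R = u k.+1.
  move=> kr; have <- : \sum_(0 <= i < k.+1) (u i.+1 - u i) = u k.+1.
    by rewrite telescope_sumr// /u/= subr0.
  rewrite big_mkord (big_ord_widen r.+1 (fun i => u i.+1 - u i))// [RHS]big_mkcond/=.
  by apply: eq_bigr => x _; rewrite /p ltnS; case: leqP; rewrite ?mulr1 ?mulr0.
have p1 : \sum_x p x = 1.
  have <- : u r.+1 = 1 by rewrite /u nth_default.
  by rewrite -pD//; apply: eq_bigr => x _; rewrite -ltnS ltn_ord mulr1.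
have [P [D [Pint [w [N Eexp]] Piid]]] := exists_iid n p0 p1.
pose c (i : nat) a := #|[set q | (D a q <= i)%N]%SET|.
(* [Q i k] is the probability that at most [k] draws have level at most [i]; its increments in [k]
   are binomial. *)
pose Q (i : nat) k := \sum_(a < N) w a * (c i a <= k)%N%:R.
have [K [KE indK KB]] := Piid (fun x => x%:R).
pose B (i : nat) : set R := `]-oo, i%:R]%classic.
have KBi i q a : (K q a \in B i) = (D a q <= i)%N.
  by rewrite KE; apply/idP/idP; rewrite inE /B/= in_itv/= ler_nat.
have levelP q i : (i < r)%N -> P (K q @^-1` B i)%classic = (u i.+1)%:E.
  move=> ir; rewrite KB -(pD i (ltnW ir)); congr EFin.
  apply: eq_bigr => x _; congr (_ * _%:R).
  by congr (nat_of_bool _); apply/idP/idP; rewrite inE /B/= in_itv/= ler_nat.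
have PD i k : (i < r)%N -> P [set a | c i a = k]%classic =
    ('C(n, k)%:R * (u i.+1 ^+ k * (1 - u i.+1) ^+ (n - k)))%:E.
  move=> ir; have -> : c i = fun a => #|[set q | K q a \in B i]%SET|.
    by apply/funext => a; apply: eq_card => q; rewrite !inE KBi.
  by apply: prob_count => //[|q]; [exact: measurable_itv | exact: levelP].
have PE (A : set nat) : P A = (\sum_(a < N) w a * ((a : nat) \in A)%:R)%:E.
  by rewrite -(@expectation_indic _ _ _ P A)// Eexp.
have QS i k : (i < r)%N ->
    Q i k.+1 - Q i k = 'C(n, k.+1)%:R * (u i.+1 ^+ k.+1 * (1 - u i.+1) ^+ (n - k.+1)).
  move=> ir; apply: EFin_inj; rewrite -PD// PE; congr EFin; rewrite -sumrB.
  apply: eq_bigr => a _; rewrite -mulrBr; congr (_ * _).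
  have -> : ((a : nat) \in [set a | c i a = k.+1]%classic) = (c i a == k.+1).
    by apply/idP/eqP; rewrite inE.
  by rewrite leq_eqVlt ltnS; case: eqVneq => [->|_]; rewrite ?ltnn ?subr0 ?subrr.
(* The expected order statistics without the offset [x0]. Their successive differences are the gaps,
   so [x0] only has to match the first one. *)
pose e0 k := \sum_(i < r) l (u i.+1) * Q i k.
pose x0 := beta`_0 - e0 0%N.
have eE k : (k < n)%N -> x0 + e0 k = beta`_k.
  elim: k => [|k IH] kn; first by rewrite /x0 subrK.
  have -> : beta`_k.+1 = gap beta k.+1 + beta`_k by rewrite /gap/= subrK.
  rewrite -IH ?(ltnW kn)// gapE//.
  rewrite (big_nth 1) big_mkord mulr_sumr.
  rewrite (_ : \sum_(i < _) _ = e0 k.+1 - e0 k); first by ring.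
  rewrite /e0 -sumrB; apply: eq_bigr => i _; rewrite -mulrBr QS// /u/=.
  by rewrite mulrCA.
pose g (x : nat) := x0 + \sum_(i < r) l (u i.+1) * (i < x)%N%:R.
have g_homo : {homo g : x y / (x <= y)%N >-> x <= y}.
  move=> x y xy; rewrite lerD2l; apply: ler_sum => i _.
  by rewrite ler_wpM2l ?l0// ler_nat; case: (ltnP i x) => // ix; rewrite (leq_trans ix xy).
have [X [XE indX XB]] := Piid (fun x => g x).
have wE (f f' : nat -> R) : (forall a, f a = f' a) -> ('E_P[f] = 'E_P[f'])%E.
  by move=> ff'; congr expectation; apply/funext.
exists _, nat, P, X; split => //.
- by move=> i j C mC; rewrite /distribution/= /pushforward !XB.
- move=> q [b Xb].
  (* Some jump of [g] is nonzero, otherwise the first gap would vanish. Levels on both sides of it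
     have positive probability, so the variable takes two distinct values. *)
  have [i li] : exists i : 'I_r, 0 < l (u i.+1).
    apply/not_existsP => h; have := gap_gt0 sb (j := 1); rewrite n1 => /(_ isT).
    rewrite gapE ?n1// (big_nth 1) big_mkord big1 ?mulr0 ?ltxx// => i _.
    have /negP := h i; rewrite lt_neqAle l0 ?su// andbT negbK => /eqP/esym.
    by rewrite /u/= => ->; rewrite mul0r.
  have PDi := levelP q i (ltn_ord i).
  have ui := s01 _ (su i).
  have [Z [mZ Z0 XZ]] := Xb.
  have hit (A : set nat) : (0 < P A)%E -> exists2 a, A a & X q a = b.
    move=> PA; apply/not_exists2P => h; move: PA; rewrite ltNge => /negP; apply.
    rewrite -Z0; apply: le_measure; rewrite ?inE// => a Aa; apply: XZ => /= Xab.
    by have [] := h a.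
  have [|a Da Xa] := hit (K q @^-1` B i)%classic.
    by rewrite PDi lte_fin; case/andP: ui.
  have [|a' Da' Xa'] := hit (~` (K q @^-1` B i))%classic.
    by rewrite probability_setC// PDi -EFinB lte_fin subr_gt0; case/andP: ui.
  have {}Da : (D a q <= i)%N by rewrite -KBi; exact/mem_set.
  have {}Da' : (i < D a' q)%N by rewrite ltnNge -KBi; apply/negP => /set_mem.
  have gi : g i < g i.+1.
    rewrite ltrD2l (bigD1 i)//= [ltRHS](bigD1 i)//= ltr_leD//.
      by rewrite ltnn mulr0 ltnSn mulr1.
    apply: ler_sum => j _; rewrite ler_wpM2l ?l0// ler_nat.
    by case: (ltnP j i) => // ji; rewrite (ltn_trans ji).
  have : g i.+1 <= g i.
    rewrite (@le_trans _ _ b)//; first by rewrite -Xa' XE g_homo.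
    by rewrite -Xa XE g_homo.
  by rewrite leNgt gi.
move=> k; rewrite (wE _ (fun a => x0 + \sum_(i < r) l (u i.+1) * (c i a <= k)%N%:R)).
  rewrite Eexp (tnth_nth 0) -eE//; congr EFin.
  have sumw : \sum_(a < N) w a = 1.
    apply: EFin_inj; rewrite -(expectation_cst P 1) Eexp; congr EFin.
    by apply: eq_bigr => a _; rewrite mulr1.
  under eq_bigr do rewrite mulrDr mulr_sumr.
  rewrite big_split/= -mulr_suml sumw mul1r exchange_big/=; congr (_ + _).
  apply: eq_bigr => i _; rewrite /Q mulr_sumr; apply: eq_bigr => a _.
  by rewrite mulrCA.
(* The order statistic of the levels exceeds [i] exactly when at most [k] draws have level at most
   [i]. *)
move=> a; have [x osE xc] := order_stat_homo (D a) k g_homo.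
transitivity (g x).
  rewrite -osE /order_stat; congr (nth _ (sort _ _) _).
  by apply: eq_map => i; rewrite XE.
by congr (_ + _); apply: eq_bigr => i _; rewrite ltnNge xc -leqNgt.
Qed.

(** * Expected gaps as integrals of the distribution function *)

Section OrderStatIntegral.
Context {R : realType} d (T : measurableType d) (P : probability T R) (n : nat).
Variable X : 'I_n -> {RV P >-> R}.

Lemma measurable_order_stat k : measurable_fun setT (order_stat X k).
Proof.
apply: (measurability _ (RGenOInfty.measurableE R)) => _ [_ [x ->] <-].
rewrite setTI; have -> : (order_stat X k @^-1` `]x, +oo[ =
    ~` \bigcup_(J in [set` [set J : {set 'I_n} | (k < #|J|)%N]%SET])
        \bigcap_(i in [set` J]) (X i @^-1` `]-oo, x]))%classic.
  apply/seteqP; split=> w /=; rewrite in_itv/= andbT ltNge order_stat_le.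
    move=> /negP kw [J /=]; rewrite inE => kJ XJ; apply: kw.
    rewrite (leq_trans kJ)// subset_leq_card//; apply/fintype.subsetP => i iJ.
    by rewrite inE; have := XJ i iJ; rewrite /= in_itv.
  move=> h; apply/negP => kw; apply: h; exists [set i | (X i w <= x)%R]%SET => /=.
    by rewrite inE.
  by move=> i /=; rewrite inE in_itv.
apply: measurableC; apply: fin_bigcup_measurable => [|J _]; first exact: finite_finset.
apply: fin_bigcap_measurable => [|i _]; first exact: finite_finset.
by rewrite -[X in measurable X]setTI; apply: measurable_funP.
Qed.

(** An order statistic is one of the sample values, hence dominated by the sum of their absolute
    values. *)
Lemma integrable_order_stat k : (forall i, P.-integrable setT (EFin \o X i)) ->
  P.-integrable setT (EFin \o order_stat X k).
Proof.
move=> Xint; apply: (@le_integrable _ _ _ _ _ measurableT _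
    (fun w => \sum_(i < n) `|(X i w)%:E|)%E).
- exact/measurable_EFinP/measurable_order_stat.
- move=> w _; rewrite /= gee0_abs ?sume_ge0// sumEFin lee_fin.
  have : order_stat X k w \in [seq X i w | i <- enum 'I_n].
    rewrite -(perm_mem (permEl (perm_sort <=%R _))) mem_nth//.
    by rewrite size_sort size_map size_enum_ord.
  move=> /mapP[i _ ->]; rewrite (bigD1 i)//= lerDl sumr_ge0//.
- apply: integrable_sum => // i _; exact/integrable_abse/Xint.
Qed.

Lemma expectation_gap (F : R -> R) j : mutually_independent X ->
  (forall i, P.-integrable setT (EFin \o X i)) ->
  (forall i x, P (X i @^-1` `]-oo, x])%classic = (F x)%:E) ->
  forall (a b : 'I_n), b = a.+1 :> nat -> b = j :> nat ->
  (\int[@lebesgue_measure R]_x ('C(n, j)%:R * (F x ^+ j * (1 - F x) ^+ (n - j)))%:E =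
   'E_P[order_stat X b] - 'E_P[order_stat X a])%E.
Proof.
move=> indX Xint XF a b ba bj; pose GR := measurableTypeR R.
pose mu : {sigma_finite_measure set GR -> \bar R} := @lebesgue_measure R.
have ab w : order_stat X a w <= order_stat X b w by rewrite order_stat_mono// ba.
(* The region between the two order statistics. Its section at an outcome is an interval whose
   length is the gap; its section at [x] is the event that exactly [j] values are at most [x]. *)
pose A : set (T * GR) := [set z | order_stat X a z.1 <= z.2 < order_stat X b z.1]%classic.
have mA : measurable A.
  have mY k : measurable_fun setT (fun z : T * GR => order_stat X k z.1).
    exact: measurableT_comp (measurable_order_stat k) measurable_fst.
  have -> : A = ((fun z : T * GR => order_stat X a z.1 <= z.2) @^-1` [set true] `&`
      (fun z : T * GR => z.2 < order_stat X b z.1) @^-1` [set true])%classic.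
    by apply/seteqP; split => z /=; [move=> /andP[] | move=> [h1 h2]; apply/andP].
  apply: measurableI.
    have : measurable_fun setT (fun z : T * GR => order_stat X a z.1 <= z.2).
      exact: measurable_fun_ler.
    by move=> /(_ measurableT [set true]%classic); rewrite setTI; exact.
  have : measurable_fun setT (fun z : T * GR => z.2 < order_stat X b z.1).
    exact: measurable_fun_ltr.
  by move=> /(_ measurableT [set true]%classic); rewrite setTI; exact.
have := indic_fubini_tonelli P mu mA.
rewrite (indic_fubini_tonelli_FE mu mA) (indic_fubini_tonelli_GE P mA).
have -> : mu \o xsection A = EFin \o (order_stat X b \- order_stat X a).
  apply/funext => w /=.
  have -> : xsection A w = `[order_stat X a w, order_stat X b w[%classic.
    by apply/seteqP; split => x /=; rewrite in_itv/= /xsection/= inE.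
  rewrite /mu/= lebesgue_measure_itv/= lte_fin -EFinB; case: ltP => // ba'.
  by rewrite (@le_anti _ R (order_stat X b w) (order_stat X a w)) ?subrr// ba' ab.
rewrite integralB_EFin//; [|exact: integrable_order_stat|exact: integrable_order_stat].
rewrite unlock => ->; apply: eq_integral => x _ /=.
rewrite -(prob_count j indX (B := `]-oo, x]%classic))//.
have cE w : [set i | X i w \in `]-oo, x]%classic]%SET = [set i | (X i w <= x)%R]%SET.
  by apply/setP => i; rewrite !inE; apply/idP/idP; rewrite inE /= in_itv.
congr (P _); apply/seteqP; split => w /=; rewrite /ysection/= inE /A/= cE.
  by move=> cj; rewrite order_stat_le ltNge order_stat_le cj bj -ltnS -ba bj ltnSn ltnn.
rewrite order_stat_le ltNge order_stat_le -leqNgt bj => /andP[h1 h2].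
by apply/eqP; rewrite eqn_leq h2 -bj ba.
Qed.

End OrderStatIntegral.

(** * The linear functional of a distribution function *)

Section CdfFunctional.
Context {R : realType}.
Notation mu := (@lebesgue_measure R).
Variables (F : R -> R) (n : nat) (g : nat -> R).
Hypotheses (mF : measurable_fun setT F) (F01 : forall x, 0 <= F x <= 1) (n1 : (1 < n)%N).
Hypothesis Fg : forall j, (0 < j < n)%N ->
  (\int[mu]_x ('C(n, j)%:R * (F x ^+ j * (1 - F x) ^+ (n - j)))%:E = (g j)%:E)%E.

Let wt x := F x * (1 - F x).

Let wt0 x : 0 <= wt x.
Proof. by have /andP[? ?] := F01 x; rewrite mulr_ge0// subr_ge0. Qed.

Let wt_cases x : wt x = 0 \/ 0 < F x < 1.
Proof.
have /andP[] := F01 x; rewrite le_eqVlt => /orP[/eqP F0 _|F0].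
  by left; rewrite /wt -F0 mul0r.
rewrite le_eqVlt => /orP[/eqP F1|F1]; last by right; rewrite F0.
by left; rewrite /wt F1 subrr mulr0.
Qed.

Let measurable_wt : measurable_fun setT wt.
Proof. by apply: measurable_funM => //; apply: measurable_funB. Qed.

Let measurable_horner p : measurable_fun setT (fun x => p.[F x]).
Proof.
apply: (measurableT_comp (f := fun y => p.[y]) _ mF).
exact: (continuous_measurable_fun (@continuous_horner R p)).
Qed.

Let wt_bernstein j x : (0 < j < n)%N ->
  wt x * (bernstein_mono n j).[F x] = F x ^+ j * (1 - F x) ^+ (n - j).
Proof.
case: j => // j /= jn; rewrite /bernstein_mono /wt !hornerE /=.
by rewrite (_ : (n - j.+1 = (n.-1 - j.+1).+1)%N) ?exprS; [ring|lia].
Qed.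

Let integrable_gap j : (0 < j < n)%N ->
  mu.-integrable setT (fun x => ('C(n, j)%:R * (wt x * (bernstein_mono n j).[F x]))%:E).
Proof.
move=> jn; apply/integrableP; split.
  by apply/measurable_EFinP; apply: measurable_funM => //;
    exact: (measurable_funM measurable_wt (measurable_horner _)).
rewrite (@eq_integral _ _ _ mu setT
  (fun x => ('C(n, j)%:R * (F x ^+ j * (1 - F x) ^+ (n - j)))%:E)).
  by rewrite Fg// ltry.
move=> x _; rewrite wt_bernstein//= ger0_norm//.
have /andP[? ?] := F01 x.
by rewrite !mulr_ge0 ?ler0n ?exprn_ge0 ?subr_ge0.
Qed.

(** By [sum_bernstein] with [k = 0], [wt] is a finite combination of the gap integrands, whose
    integrals are finite. *)
Let integrable_wt : mu.-integrable setT (EFin \o wt).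
Proof.
have -> : EFin \o wt = (fun x => \sum_(1 <= j < n)
    (('C(n.-2 - 0, j.-1 - 0)%:R / 'C(n, j)%:R)%:E *
     ('C(n, j)%:R * (wt x * (bernstein_mono n j).[F x]))%:E))%E.
  apply/funext => x /=.
  have {1}-> : wt x = wt x * ('X^0).[F x] by rewrite expr0 hornerC mulr1.
  rewrite -(@sum_bernstein _ n 0) ?horner_sum; last by lia.
  rewrite mulr_sumr -sumEFin; apply: eq_big_nat => j jn.
  rewrite -EFinM hornerZ; congr EFin.
  have : 'C(n, j)%:R != 0 :> R by rewrite pnatr_eq0 -lt0n bin_gt0; lia.
  by move=> ?; field.
under eq_fun do rewrite big_nat_cond.
apply: integrable_sum => // j /andP[jn _].
exact: (integrableZl measurableT _ (integrable_gap jn)).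
Qed.

(** On the unit interval a polynomial is bounded by the sum [M] of its absolute coefficients. *)
Let integrable_wt_horner p : mu.-integrable setT (fun x => (wt x * p.[F x])%:E).
Proof.
pose M := \sum_(i < size p) `|p`_i|.
apply: (@le_integrable _ _ _ mu _ measurableT _ (fun x => M%:E * (EFin \o wt) x)%E).
- by apply/measurable_EFinP; exact: (measurable_funM measurable_wt (measurable_horner _)).
- move=> x _ /=; rewrite lee_fin !normrM mulrC ler_wpM2r//.
  rewrite horner_coef (le_trans (ler_norm_sum _ _ _))// [leRHS]ger0_norm ?sumr_ge0//.
  apply: ler_sum => i _; rewrite normrM ler_piMr// normrX.
  have /andP[F0 F1] := F01 x.
  by rewrite exprn_ile1// ger0_norm.
- exact: (integrableZl measurableT _ integrable_wt).
Qed.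

Let L0 p := \int[mu]_(x in setT) (wt x * p.[F x]).

Let L0_scalar : scalar L0.
Proof.
move=> a p q; rewrite /L0 -(RintegralZl a measurableT (integrable_wt_horner p)).
rewrite -(RintegralD measurableT _ (integrable_wt_horner q)).
  by apply: eq_Rintegral => x _; rewrite hornerD hornerZ; ring.
by have := integrable_wt_horner (a *: p); under eq_fun do rewrite hornerZ mulrCA.
Qed.

(** The last clause expresses that the measure lives on the open interval: if [L p = 0], then almost
    everywhere either [wt] vanishes or [F x] is a root of [p] in (0,1). It later yields the
    inclusions between kernels of forms. *)
Lemma exists_cdf_functional : exists L : {scalar {poly R}},
  [/\ gaps_repr n g L,
      forall p, (forall x, 0 < x < 1 -> 0 <= p.[x]) -> 0 <= L p &
      forall p q, (forall x, 0 < x < 1 -> 0 <= p.[x]) ->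
        (forall x, 0 < x < 1 -> p.[x] = 0 -> q.[x] = 0) -> L p = 0 -> L q = 0].
Proof.
pose L : {scalar {poly R}} := HB.pack L0 (GRing.isLinear.Build _ _ _ _ L0 L0_scalar).
have wtp p x : (forall x, 0 < x < 1 -> 0 <= p.[x]) -> 0 <= wt x * p.[F x].
  by move=> p0; have [->|Fx] := wt_cases x; rewrite ?mul0r// mulr_ge0// p0.
exists L; split => [j jn|p p0|p q p0 pq Lp].
- have := congr1 fine (Fg jn); rewrite /= => <-.
  rewrite -(RintegralZl _ measurableT (integrable_wt_horner _)).
  by congr fine; apply: eq_integral => x _; rewrite wt_bernstein.
- exact: (@Rintegral_ge0 _ _ _ mu setT _ (fun x _ => wtp p x p0)).
have intp : (\int[mu]_x `|(wt x * p.[F x])%:E| = 0)%E.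
  rewrite (@eq_integral _ _ _ mu setT (fun x => (wt x * p.[F x])%:E)).
    by rewrite -[LHS]fineK ?[fine _]Lp//; apply: integrable_fin_num.
  by move=> x _; rewrite /= ger0_norm// wtp.
have mfun r : measurable_fun setT (fun x => (wt x * r.[F x])%:E).
  by apply/measurable_EFinP; exact: (measurable_funM measurable_wt (measurable_horner _)).
have aep := (ae_eq_integral_abs mu measurableT (mfun p)).1 intp.
suff intq : (\int[mu]_x `|(wt x * q.[F x])%:E| = 0)%E.
  rewrite /= /L0 /Rintegral; apply: EFin_inj; rewrite fineK; last exact: integrable_fin_num.
  apply/eqP; rewrite -abse_eq0 eq_le abse_ge0 andbT -intq.
  exact: (le_abse_integral mu measurableT (mfun q)).
apply: (ae_eq_integral_abs mu measurableT (mfun q)).2.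
apply: filterS aep => x + _ => /(_ I) /= [] /eqP.
rewrite mulf_eq0 => wp; congr EFin.
have [->|Fx] := wt_cases x; first by rewrite mul0r.
move: wp; rewrite /wt mulf_eq0 subr_eq0.
case/andP: (Fx) => F0 F1; rewrite gt_eqF// [1 == _]gt_eqF//= => /eqP p_0.
by rewrite pq ?mulr0.
Qed.

End CdfFunctional.

Lemma EOS_functional (R : realType) n (beta : n.-tuple R) : (1 < n)%N -> EOS beta ->
  exists L : {scalar {poly R}},
  [/\ gaps_repr n (gap beta) L,
      forall p, (forall x, 0 < x < 1 -> 0 <= p.[x]) -> 0 <= L p &
      forall p q, (forall x, 0 < x < 1 -> 0 <= p.[x]) ->
        (forall x, 0 < x < 1 -> p.[x] = 0 -> q.[x] = 0) -> L p = 0 -> L q = 0].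
Proof.
move=> n1 [d [T [P [X [indX idX Xint _ XE]]]]].
have n0 : (0 < n)%N by exact: ltnW.
pose i0 := Ordinal n0; pose F x := fine (P (X i0 @^-1` `]-oo, x])%classic).
have XF i x : P (X i @^-1` `]-oo, x])%classic = (F x)%:E.
  rewrite fineK ?fin_num_measure//; first exact: (idX i i0 _ (measurable_itv _)).
  by rewrite -[X in measurable X]setTI; apply: measurable_funP.
apply: (@exists_cdf_functional _ F) => //.
- apply: nondecreasing_measurable => // x y xy; rewrite -lee_fin -!(XF i0).
  exact: (cdf_nondecreasing (X i0)).
- move=> x; rewrite -!lee_fin -(XF i0) measure_ge0/=.
  apply: probability_le1; rewrite -[X in measurable X]setTI; exact: measurable_funP.
move=> j /andP[j0 jn].
have j1n : (j.-1 < n)%N by rewrite (leq_ltn_trans (leq_pred _)).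
rewrite (@expectation_gap _ _ _ _ _ X F j indX Xint XF (Ordinal j1n) (Ordinal jn))//=.
  by rewrite !XE -EFinB /gap !(tnth_nth 0).
by rewrite prednK.
Qed.

(** * The characterization *)

Section MomentMatrices.
Context {R : realType}.

Lemma psd_shift n (A B : 'M[R]_n) : possemidef A -> possemidef B ->
  (forall v : 'rV_n, (v *m A *m v^T) 0 0 = 0 -> (v *m B *m v^T) 0 0 = 0) ->
  exists2 c : R, 0 < c & forall e, 0 <= e <= c -> possemidef (A - e *: B).
Proof.
move=> psdA psdB kerAB; have [c c0 cBA] := psd_compare psdA psdB kerAB.
exists c => // e /andP[e0 ec]; split; first by rewrite linearB linearZ/= psdA.1 psdB.1.
move=> v; rewrite mulmxBr mulmxBl -scalemxAr -scalemxAl mxE [X in _ + X]mxE [X in _ - X]mxE.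
by rewrite subr_ge0 (le_trans _ (cBA v))// ler_wpM2r// psdB.2.
Qed.

Lemma posdef_possemidef n (A : 'M[R]_n) : posdef A -> possemidef A.
Proof.
move=> [symA posA]; split=> // v; have [->|v0] := eqVneq v 0; last exact/ltW/posA.
by rewrite mul0mx mul0mx mxE.
Qed.

Lemma posdef_isotropic n (A B : 'M[R]_n) (v : 'rV[R]_n) : posdef A ->
  (v *m A *m v^T) 0 0 = 0 -> (v *m B *m v^T) 0 0 = 0.
Proof.
move=> [_ posA]; have [->|v0 vA] := eqVneq v 0; first by rewrite !mul0mx mxE.
by have := posA v v0; rewrite vA ltxx.
Qed.

Lemma common_eps (c1 c2 : R) : 0 < c1 -> 0 < c2 ->
  exists2 e, 0 < e < 2^-1 & e <= c1 /\ e <= c2.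
Proof.
move=> c10 c20; exists (Num.min 3^-1 (Num.min c1 c2)).
  rewrite !lt_min c10 c20 invr_gt0 ltr0n/= gt_min; apply/orP; left; lra.
by rewrite !ge_min !lexx !orbT.
Qed.

Variables (n : nat) (beta : n.-tuple R) (L : {scalar {poly R}}).
Hypothesis nuL : forall k, (k < n.-1)%N -> nu beta k = L 'X^k.

Definition hankel d : 'M[R]_d := \matrix_(i, j) nu beta (i + j).

Lemma hankel_entry d : (d.*2 <= n)%N -> forall i j : 'I_d,
  hankel d i j = L (1 * 'X^(i + j)).
Proof.
by move=> dn i j; rewrite mxE mul1r nuL//; have := ltn_ord i; have := ltn_ord j; lia.
Qed.

Lemma A0_entry m e : n = (2 * m + 2)%N -> forall i j : 'I_m.+1,
  A0 beta m e i j = L (1 * 'X^(i + j)).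
Proof.
by move=> nm i j; rewrite mxE mul1r nuL//; have := ltn_ord i; have := ltn_ord j; lia.
Qed.

Lemma B0_entry m e : n = (2 * m + 2)%N -> forall i j : 'I_m,
  B0 beta m e i j = L (('X - e%:P) * ((1 - e)%:P - 'X) * 'X^(i + j)).
Proof.
move=> nm i j; have ltim := ltn_ord i; have ltjm := ltn_ord j; rewrite mxE !nuL; [|lia|lia|lia].
rewrite -linearZ/= -!linearB/=; congr (L _).
by rewrite addn1 addn2 !exprS -mul_polyC polyCM polyCB; ring.
Qed.

Lemma A1_entry m e : n = (2 * m + 3)%N -> forall i j : 'I_m.+1,
  A1 beta m e i j = L (('X - e%:P) * 'X^(i + j)).
Proof.
move=> nm i j; have ltim := ltn_ord i; have ltjm := ltn_ord j; rewrite mxE !nuL; [|lia|lia].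
by rewrite functional_XsubC addn1 exprS.
Qed.

Lemma B1_entry m e : n = (2 * m + 3)%N -> forall i j : 'I_m.+1,
  B1 beta m e i j = L (((1 - e)%:P - 'X) * 'X^(i + j)).
Proof.
move=> nm i j; have ltim := ltn_ord i; have ltjm := ltn_ord j; rewrite mxE !nuL; [|lia|lia].
by rewrite functional_CsubX addn1 exprS.
Qed.

Lemma B0_shift m e : B0 beta m e = B0 beta m 0 - (e * (1 - e)) *: hankel m.
Proof. by apply/matrixP => i j; rewrite !mxE; ring. Qed.

Lemma A1_shift m e : A1 beta m e = A1 beta m 0 - e *: hankel m.+1.
Proof. by apply/matrixP => i j; rewrite !mxE; ring. Qed.

Lemma B1_shift m e : B1 beta m e = B1 beta m 0 - e *: hankel m.+1.
Proof. by apply/matrixP => i j; rewrite !mxE; ring. Qed.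

Lemma exists_eps_even m : n = (2 * m + 2)%N ->
  possemidef (A0 beta m 0) -> possemidef (B0 beta m 0) ->
  (forall v : 'rV_m, (v *m B0 beta m 0 *m v^T) 0 0 = 0 ->
     (v *m hankel m *m v^T) 0 0 = 0) ->
  exists eps : R, 0 < eps < 2^-1 /\
    possemidef (A0 beta m eps) /\ possemidef (B0 beta m eps).
Proof.
move=> nm psdA psdB ker.
have psdH : possemidef (hankel m).
  apply/(hankel_psd (hankel_entry _)); first lia.
  exact/(psd_formS (leqnSn m))/(hankel_psd (A0_entry 0 nm)).
have [c c0 cB] := psd_shift psdB psdH ker.
have [e /[dup] e2 /andP[e0 e1] [ec _]] := common_eps c0 c0.
exists e; split => //; split.
  by apply/(hankel_psd (A0_entry _ nm))/(hankel_psd (A0_entry 0 nm)).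
(* The shift is [e * (1 - e)], which is nonnegative and at most [e <= c]. *)
by rewrite B0_shift; apply: cB; nra.
Qed.

Lemma exists_eps_odd m : n = (2 * m + 3)%N ->
  possemidef (A1 beta m 0) -> possemidef (B1 beta m 0) ->
  (forall v : 'rV_m.+1, (v *m A1 beta m 0 *m v^T) 0 0 = 0 ->
     (v *m hankel m.+1 *m v^T) 0 0 = 0) ->
  (forall v : 'rV_m.+1, (v *m B1 beta m 0 *m v^T) 0 0 = 0 ->
     (v *m hankel m.+1 *m v^T) 0 0 = 0) ->
  exists eps : R, 0 < eps < 2^-1 /\
    possemidef (A1 beta m eps) /\ possemidef (B1 beta m eps).
Proof.
move=> nm psdA psdB kerA kerB.
have psdH : possemidef (hankel m.+1).
  apply/(hankel_psd (hankel_entry _)); first lia.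
  (* At [eps = 0] the weights are ['X] and [1 - 'X], whose sum is 1. *)
  apply: (@form_ge0 _ L 0 1).
  - exact: ltr01.
  - exact/(hankel_psd (A1_entry 0 nm)).
  - by have /(hankel_psd (B1_entry 0 nm)) := psdB; rewrite subr0.
have [c1 c10 cA] := psd_shift psdA psdH kerA.
have [c2 c20 cB] := psd_shift psdB psdH kerB.
have [e /[dup] e2 /andP[e0 e1] [ec1 ec2]] := common_eps c10 c20.
exists e; split => //; split.
  by rewrite A1_shift; apply: cA; rewrite (ltW e0).
by rewrite B1_shift; apply: cB; rewrite (ltW e0).
Qed.

Lemma size_bernstein_mono j : (0 < j < n)%N -> (size (bernstein_mono n j : {poly R}) <= n.-1)%N.
Proof.
move=> jn; rewrite (leq_trans (size_polyMleq _ _))// size_polyXn.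
have : (size (1 - 'X : {poly R})%R <= 2)%N.
  by rewrite (leq_trans (size_polyD _ _))// size_polyN size_polyX size_poly1.
have := size_poly_exp_leq (1 - 'X : {poly R}) (n.-1 - j).
set a := size _; set b := size _ => h1 h2.
have : (a <= (n.-1 - j).+1)%N by rewrite (leq_trans h1)// ltnS; nia.
lia.
Qed.

Lemma EOS_of_quadrature (s : seq R) (w : R -> R) : (1 < n)%N -> sorted <%R beta ->
  (forall t, t \in s -> 0 < t < 1) -> (forall t, t \in s -> 0 <= w t) ->
  (forall p : {poly R}, (size p <= n.-1)%N -> L p = \sum_(t <- s) w t * p.[t]) -> EOS beta.
Proof.
move=> n1 sb s01 w0 Ls; have gL := gaps_repr_nu n1 sb nuL.
pose c := lam beta / (n.-1%:R * n%:R).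
have c0 : 0 < c by rewrite divr_gt0 ?lam_gt0// mulr_gt0// ltr0n; lia.
(* A node of mass [w t] comes from an interval on which the distribution function equals [t];
   dividing by the density [t * (1 - t)] recovers its length. *)
pose l t := c * w t / (t * (1 - t)).
apply: (@EOS_of_atoms _ _ _ (sort <=%R s) l) => //.
- exact: sort_le_sorted.
- by move=> t; rewrite mem_sort; exact: s01.
- move=> t; rewrite mem_sort => ts; have /andP[t0 t1] := s01 t ts.
  by apply: divr_ge0; apply: mulr_ge0; rewrite ?w0 ?subr_ge0 ?ltW.
move=> j jn; rewrite gL//= -/c Ls; last exact: size_bernstein_mono.
congr (_ * _); rewrite (perm_big _ (permEl (perm_sort <=%R s)))/=.
rewrite /GRing.scale/= mulr_sumr !big_seq; apply: eq_bigr => t ts.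
have /andP[t0 t1] := s01 t ts.
have -> : t ^+ j * (1 - t) ^+ (n - j) = t * (1 - t) * (bernstein_mono n j).[t].
  case: j jn => // j jn; rewrite /bernstein_mono !hornerE/=.
  by rewrite (_ : (n - j.+1 = (n.-1 - j.+1).+1)%N) ?exprS; [ring|lia].
by rewrite /l; field; rewrite subr_eq0 !gt_eqF.
Qed.

End MomentMatrices.

Section Characterization.
Context {R : realType} (n : nat) (beta : n.-tuple R).
Hypotheses (n1 : (1 < n)%N) (sb : sorted <%R beta).

Let eps_node (e t : R) : 0 < e -> e <= t <= 1 - e -> 0 < t < 1.
Proof. by move=> e0 /andP[h1 h2]; apply/andP; split; lra. Qed.

Lemma EOS_of_psd_odd m e : n = (2 * m + 3)%N -> 0 < e < 2^-1 ->
  possemidef (A1 beta m e) -> possemidef (B1 beta m e) -> EOS beta.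
Proof.
move=> nm /andP[e0 e1]; have [L LE] := exists_functional (nu beta) n.-1.
have nuL k : (k < n.-1)%N -> nu beta k = L 'X^k by move=> ?; rewrite LE.
move=> /(hankel_psd (A1_entry nuL e nm)) La /(hankel_psd (B1_entry nuL e nm)) Lb.
have [|s [w [ws w0 Ls]]] := gauss_quadrature _ La Lb; first lra.
apply: (EOS_of_quadrature nuL n1 sb _ w0) => [t /ws|p pn]; first exact: eps_node.
by apply: Ls; lia.
Qed.

Lemma EOS_of_psd_even m e : n = (2 * m + 2)%N -> 0 < e < 2^-1 ->
  possemidef (A0 beta m e) -> possemidef (B0 beta m e) -> EOS beta.
Proof.
move=> nm /andP[e0 e1]; have [L LE] := exists_functional (nu beta) n.-1.
have nuL k : (k < n.-1)%N -> nu beta k = L 'X^k by move=> ?; rewrite LE.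
move=> /(hankel_psd (A0_entry nuL e nm)) L1 /(hankel_psd (B0_entry nuL e nm)) Lab.
have [|L' [L'E La Lb]] := psd_form_extension _ L1 Lab; first lra.
have [|s [w [ws w0 Ls]]] := gauss_quadrature _ La Lb; first lra.
apply: (EOS_of_quadrature nuL n1 sb _ w0) => [t /ws|p pn]; first exact: eps_node.
by rewrite -L'E ?Ls//; lia.
Qed.

Lemma EOS_positive_functional : EOS beta -> exists L : {scalar {poly R}},
  [/\ forall k, (k < n.-1)%N -> nu beta k = L 'X^k,
      forall p, (forall x, 0 < x < 1 -> 0 <= p.[x]) -> 0 <= L p &
      forall p q, (forall x, 0 < x < 1 -> 0 <= p.[x]) ->
        (forall x, 0 < x < 1 -> p.[x] = 0 -> q.[x] = 0) -> L p = 0 -> L q = 0].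
Proof.
move=> /(EOS_functional n1)[L [gL L0 Lz]]; have [c c0 cE] := nu_repr n1 sb gL.
exists (c \*: L); split => [//|p p0|p q p0 pq /eqP].
  by rewrite /= mulr_ge0 ?L0// ltW.
rewrite /= mulf_eq0 gt_eqF//= => /eqP Lp.
by rewrite (Lz p q p0 pq Lp) scaler0.
Qed.

Let sqr_form_ge0 (u p : {poly R}) : (forall x, 0 < x < 1 -> 0 < u.[x]) ->
  forall x, 0 < x < 1 -> 0 <= (u * p ^+ 2).[x].
Proof. by move=> u0 x x01; rewrite hornerM horner_exp mulr_ge0 ?sqr_ge0// ltW// u0. Qed.

Let sqr_form_kernel (u v p : {poly R}) : (forall x, 0 < x < 1 -> 0 < u.[x]) ->
  forall x, 0 < x < 1 -> (u * p ^+ 2).[x] = 0 -> (v * p ^+ 2).[x] = 0.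
Proof.
move=> u0 x x01 /eqP; rewrite !hornerM mulf_eq0 gt_eqF ?u0//= => /eqP->.
by rewrite mulr0.
Qed.

Lemma psd_odd_of_EOS m : n = (2 * m + 3)%N -> EOS beta ->
  exists eps : R, 0 < eps < 2^-1 /\
    possemidef (A1 beta m eps) /\ possemidef (B1 beta m eps).
Proof.
move=> nm /EOS_positive_functional[L [nuL L0 Lz]].
have ua x : 0 < x < 1 -> 0 < ('X - 0%:P : {poly R}).[x].
  by rewrite !hornerE subr0 => /andP[].
have ub x : 0 < x < 1 -> 0 < ((1 - 0)%:P - 'X : {poly R}).[x].
  by rewrite !hornerE subr0 subr_gt0 => /andP[].
have dn : (m.+1.*2 <= n)%N by lia.
apply: (exists_eps_odd nuL) => //.
- by apply/(hankel_psd (A1_entry nuL 0 nm)) => p _; exact/L0/sqr_form_ge0.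
- by apply/(hankel_psd (B1_entry nuL 0 nm)) => p _; exact/L0/sqr_form_ge0.
- move=> v; rewrite (hankel_formE _ (A1_entry nuL 0 nm)) (hankel_formE _ (hankel_entry nuL dn)).
  by apply: Lz; [exact: sqr_form_ge0 | exact: sqr_form_kernel].
- move=> v; rewrite (hankel_formE _ (B1_entry nuL 0 nm)) (hankel_formE _ (hankel_entry nuL dn)).
  by apply: Lz; [exact: sqr_form_ge0 | exact: sqr_form_kernel].
Qed.

Lemma psd_even_of_EOS m : n = (2 * m + 2)%N -> EOS beta ->
  exists eps : R, 0 < eps < 2^-1 /\
    possemidef (A0 beta m eps) /\ possemidef (B0 beta m eps).
Proof.
move=> nm /EOS_positive_functional[L [nuL L0 Lz]].
have u1 x : 0 < x < 1 -> 0 < (1 : {poly R}).[x] by rewrite hornerC.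
have uab x : 0 < x < 1 -> 0 < (('X - 0%:P) * ((1 - 0)%:P - 'X) : {poly R}).[x].
  by rewrite !hornerE !subr0 => /andP[x0 x1]; rewrite mulr_gt0// subr_gt0.
have dn : (m.*2 <= n)%N by lia.
apply: (exists_eps_even nuL) => //.
- by apply/(hankel_psd (A0_entry nuL 0 nm)) => p _; exact/L0/sqr_form_ge0.
- by apply/(hankel_psd (B0_entry nuL 0 nm)) => p _; exact/L0/sqr_form_ge0.
- move=> v; rewrite (hankel_formE _ (B0_entry nuL 0 nm)) (hankel_formE _ (hankel_entry nuL dn)).
  by apply: Lz; [exact: sqr_form_ge0 | exact: sqr_form_kernel].
Qed.

(** Definite matrices have no nonzero isotropic vector, so the kernel conditions of [exists_eps_odd]
    are automatic. *)
Lemma EOS_of_posdef_odd m : n = (2 * m + 3)%N ->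
  posdef (A1 beta m 0) -> posdef (B1 beta m 0) -> EOS beta.
Proof.
move=> nm pA pB; have [L LE] := exists_functional (nu beta) n.-1.
have nuL k : (k < n.-1)%N -> nu beta k = L 'X^k by move=> ?; rewrite LE.
have [||v||e [e01 [psdA psdB]]] := exists_eps_odd nuL nm.
- exact: posdef_possemidef.
- exact: posdef_possemidef.
- exact: posdef_isotropic.
- by move=> v; exact: posdef_isotropic.
- exact: EOS_of_psd_odd e01 psdA psdB.
Qed.

Lemma EOS_of_posdef_even m : n = (2 * m + 2)%N ->
  posdef (A0 beta m 0) -> posdef (B0 beta m 0) -> EOS beta.
Proof.
move=> nm pA pB; have [L LE] := exists_functional (nu beta) n.-1.
have nuL k : (k < n.-1)%N -> nu beta k = L 'X^k by move=> ?; rewrite LE.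
have [||v|e [e01 [psdA psdB]]] := exists_eps_even nuL nm.
- exact: posdef_possemidef.
- exact: posdef_possemidef.
- exact: posdef_isotropic.
- exact: EOS_of_psd_even e01 psdA psdB.
Qed.

End Characterization.

(** * A two-point law violating definiteness *)

Section TwoPointLaw.
Context {R : realType} (n : nat).
Hypothesis n3 : (3 < n)%N.

(* The expected order statistics of a law with two atoms of mass [1/2], for
   which the normalized moments are those of the Dirac mass at [1/2]. *)
Definition two_point_beta : n.-tuple R :=
  [tuple of mkseq (fun k => \sum_(i < k.+1) 'C(n, i)%:R) n].

Lemma gap_two_point j : (0 < j < n)%N -> gap two_point_beta j = 'C(n, j)%:R.
Proof.
case: j => // j jn; rewrite /gap !nth_mkseq//=; last exact: ltnW.
by rewrite [X in X - _]big_ord_recr addrC addKr.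
Qed.

Lemma sorted_two_point : sorted <%R two_point_beta.
Proof.
apply/(sortedP 0) => j; rewrite size_tuple => jn.
rewrite -subr_gt0; have /= := gap_two_point (j := j.+1); rewrite jn /gap/= => ->//.
by rewrite ltr0n bin_gt0 ltnW.
Qed.

Lemma EOS_two_point : EOS two_point_beta.
Proof.
(* The distance [2 ^+ n] between the two atoms cancels the factor [2^-1 ^+ n] in every gap. *)
apply: (@EOS_of_atoms _ _ _ [:: 2^-1] (fun=> 2 ^+ n)) => //.
- by apply: leq_trans n3.
- exact: sorted_two_point.
- by move=> t; rewrite inE => /eqP->; apply/andP; split; lra.
move=> j jn; rewrite gap_two_point// big_seq1.
rewrite (_ : 1 - 2^-1 = 2^-1 :> R); last by lra.
rewrite -exprD subnKC; last by lia.
by rewrite exprVn mulfV ?mulr1// expf_neq0.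
Qed.

Lemma nu_two_point : exists L : {scalar {poly R}},
  (forall k, (k < n.-1)%N -> nu two_point_beta k = L 'X^k) /\
  (forall p, p.[2^-1] = 0 -> L p = 0).
Proof.
(* Each [bernstein_mono n j] takes the value [2^-1 ^+ n.-2] at the node. *)
pose L : {scalar {poly R}} := 2 ^+ n.-2 \*: horner_eval (2^-1 : R).
have gL : gaps_repr n (gap two_point_beta) L.
  move=> j jn; rewrite gap_two_point// /L/= /horner_eval /bernstein_mono.
  rewrite hornerM hornerXn horner_exp (_ : (1 - 'X).[2^-1] = 2^-1); last first.
    by rewrite !hornerE; lra.
  rewrite -exprD (_ : (j.-1 + (n.-1 - j) = n.-2)%N); last by lia.
  by rewrite exprVn /GRing.scale/= mulfV ?mulr1// expf_neq0.
have n1 : (1 < n)%N by apply: leq_trans n3.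
have [c c0 cE] := nu_repr n1 sorted_two_point gL.
exists (c \*: L); split => // p p0.
by rewrite /L/= /horner_eval p0 !scaler0.
Qed.

(** The polynomial ['X - (2^-1)%:P] is isotropic for every weight, and it has a coefficient vector
    once the matrix has order at least 2. *)
Lemma not_posdef_two_point (L : {scalar {poly R}}) u d (M : 'M[R]_d.+2) :
  (forall p, p.[2^-1] = 0 -> L p = 0) ->
  (forall i j : 'I_d.+2, M i j = L (u * 'X^(i + j))) -> ~ posdef M.
Proof.
move=> Lz ME [_ posM]; pose p : {poly R} := 'X - (2^-1)%:P.
have sp : (size p <= d.+2)%N by rewrite size_XsubC.
have := posM (poly_rV p); rewrite (hankel_formE _ ME) poly_rV_K// Lz ?ltxx; last first.
  by rewrite hornerM horner_exp hornerXsubC subrr expr0n mulr0.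
move=> /contraNT /(_ isT) /eqP p0; have := poly_rV_K sp; rewrite p0 linear0 => /esym/eqP.
by rewrite polyXsubC_eq0.
Qed.

End TwoPointLaw.

Theorem theorem3 (R : realType) (n : nat) (hn : (4 <= n)%N) :
  (forall beta : n.-tuple R, sorted <%R beta -> 0 < lam beta) /\
  (* (i) *)
  (forall m : nat, n = (2 * m + 2)%N ->
    forall beta : n.-tuple R, sorted <%R beta ->
      (EOS beta <->
       exists eps : R, 0 < eps < 2^-1 /\
         possemidef (A0 beta m eps) /\ possemidef (B0 beta m eps))) /\
  (* (ii) *)
  (forall m : nat, n = (2 * m + 3)%N ->
    forall beta : n.-tuple R, sorted <%R beta ->
      (EOS beta <->
       exists eps : R, 0 < eps < 2^-1 /\
         possemidef (A1 beta m eps) /\ possemidef (B1 beta m eps))) /\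
  (* (iii) *)
  (forall m : nat, n = (2 * m + 2)%N ->
    (forall beta : n.-tuple R, sorted <%R beta ->
       posdef (A0 beta m 0) /\ posdef (B0 beta m 0) -> EOS beta) /\
    (exists beta : n.-tuple R, sorted <%R beta /\ EOS beta /\
       ~ (posdef (A0 beta m 0) /\ posdef (B0 beta m 0)))) /\
  (forall m : nat, n = (2 * m + 3)%N ->
    (forall beta : n.-tuple R, sorted <%R beta ->
       posdef (A1 beta m 0) /\ posdef (B1 beta m 0) -> EOS beta) /\
    (exists beta : n.-tuple R, sorted <%R beta /\ EOS beta /\
       ~ (posdef (A1 beta m 0) /\ posdef (B1 beta m 0)))).
Proof.
have n1 : (1 < n)%N by apply: leq_trans hn.
split; first by move=> beta; exact: lam_gt0.
split.
  move=> m nm beta sb; split; first exact: psd_even_of_EOS.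
  by move=> [e [e01 [psdA psdB]]]; exact: EOS_of_psd_even nm e01 psdA psdB.
split.
  move=> m nm beta sb; split; first exact: psd_odd_of_EOS.
  by move=> [e [e01 [psdA psdB]]]; exact: EOS_of_psd_odd nm e01 psdA psdB.
have [L [nuL Lz]] := @nu_two_point R n hn.
split.
  move=> m nm; split=> [beta sb [pA pB]|]; first exact: EOS_of_posdef_even nm pA pB.
  exists (two_point_beta n); split; first exact: sorted_two_point.
  split; first exact: EOS_two_point.
  (* Since [n >= 4], [m] is positive and the matrix has order at least 2. *)
  move=> [+ _]; case: m nm => [|m] nm; first by exfalso; lia.
  exact: not_posdef_two_point Lz (A0_entry nuL 0 nm).
move=> m nm; split=> [beta sb [pA pB]|]; first exact: EOS_of_posdef_odd nm pA pB.
exists (two_point_beta n); split; first exact: sorted_two_point.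
split; first exact: EOS_two_point.
move=> [+ _]; case: m nm => [|m] nm; first by exfalso; lia.
exact: not_posdef_two_point Lz (A1_entry nuL 0 nm).
Qed.
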